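(* Let $L\subset\mathbb{Z}^n$ be a lattice and let $\mu(I_L)$ be the cardinality of a cardinality-minimal generating set of $I_L$. Then $$\mu(I_L)=\operatorname{rank}(L_{pure})+\sum_{\overline F\ne\overline F_{\{1\}}}\bigl(t(\overline F)-1\bigr),$$ where the sum runs over all distinct equivalence classes $\overline F$ of Markov fibers $F$ with $\overline F\neq\overline F_{\{1\}}$.
   Context: Let $\Bbbk$ be a field, $R=\Bbbk[x_1,\ldots,x_n]$, $\mathbb{N}=\mathbb{Z}_{\ge 0}$, $[n]=\{1,\dots,n\}$. A lattice is a subgroup $L\subset\mathbb{Z}^n$; its lattice ideal is $I_L=\langle x^{u}-x^{v}: u,v\in\mathbb{N}^n,\ u-v\in L\rangle\subset R$. A binomial means a difference $x^u-x^v$ of two distinct monomials. A minimal generating set of $I_L$ is a set of binomials that is a minimal (under inclusion) system of generators of $I_L$; it is a cardinality-minimal generating set if it has the least cardinality among all minimal generating sets. $L^+=L\cap\mathbb{N}^n$; $L_{pure}$ is the subgroup of $L$ generated by $L^+$; $\operatorname{supp}(u)=\{i:u_i\ne0\}$; $\sigma=\bigcup_{w\in L^+}\operatorname{supp}(w)\subset[n]$. For $u\in\mathbb{Z}^n$, $u^\sigma=(u_i)_{i\notin\sigma}$ (with $u^{[n]}=0$ if $\sigma=[n]$). An $I_L$-fiber is a set of the form $F_u=\{x^v: v\in\mathbb{N}^n,\ v-u\in L\}$ with $u\in\mathbb{N}^n$. For a binomial $B=x^u-x^v\in I_L$, $F_B:=F_u=F_v$. $F_{\{1\}}$ is the fiber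 containing $1$. Fibers $F,G$ are equivalent if there are $u,v\in\mathbb{N}^n$ with $x^uF\subset G$ and $x^vG\subset F$; $\overline F$ denotes the equivalence class of $F$. Write $\overline F\le_{I_L}\overline G$ if there is $u\in\mathbb{N}^n$ with $x^uF\subset G$ (a well-defined partial order on classes), and $\overline F<_{I_L}\overline G$ if moreover $\overline F\ne\overline G$. An $I_L$-fiber $F$ is a Markov fiber if there is a cardinality-minimal generating set $S$ of $I_L$ and $B\in S$ with $\overline{F_B}=\overline F$. Let $I_{L,<\overline F}$ be the ideal generated by all binomials $B\in I_L$ with $\overline{F_B}<_{I_L}\overline F$ (it is $0$ if there are none). Let $M_F$ be the monomial ideal generated by the elements of $F$, $G(M_F)$ its minimal set of monomial generators, and $G(M_F)^\sigma=\{x^{u^\sigma}:x^u\in G(M_F)\}=\{x^{a_1^\sigma},\ldots,x^{a_k^\sigma}\}$ (distinct elements, with $x^{a_i}\in G(M_F)$). The graph $G_{\overline F}$ has vertex set $[k]$, and $\{i,j\}$ is an edge iff there exist $x^{u_i},x^{u_j}\in F$ with $u_i^\sigma=a_i^\sigma$, $u_j^\sigma=a_j^\sigma$ and $x^{u_i}-x^{u_j}\in I_{L,<\overline F}$ (independent, up to reordering of vertices, of the representative $F$ of $\overline F$). $\Gamma_{\overline F}$ is the complete graph whose vertices are the connected components of $G_{\overline F}$, and $t(\overline F)$ is its number of vertices, i.e. the number of connected components of $G_{\overline F}$. *)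

(* Defs.v *)
From mathcomp Require Export all_boot all_order all_algebra.
From mathcomp Require Export finmap mpoly.
From mathcomp Require Export boolp classical_sets functions cardinality fsbigop.

Set Implicit Arguments.
Unset Strict Implicit.
Unset Printing Implicit Defensive.

Import GRing.Theory.

Local Open Scope classical_set_scope.
Local Open Scope card_scope.
Local Open Scope ring_scope.

(* Ideals *)

Definition is_ideal (R : comNzRingType) (I : set R) : Prop :=
  [/\ I 0, (forall x y, I x -> I y -> I (x + y))
    & (forall a x, I x -> I (a * x))].

Definition ideal_gen (R : comNzRingType) (S : set R) : set R :=
  smallest (@is_ideal R) S.

Definition minimal_system (R : comNzRingType) (I S : set R) : Prop :=
  ideal_gen S = I /\
  (forall T : set R, T `<=` S -> ideal_gen T = I -> T = S).

(* Lattices in Z^n *)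

Definition is_lattice (n : nat) (L : set 'rV[int]_n) : Prop :=
  L 0 /\ (forall x y, L x -> L y -> L (x - y)).

(* [has_rank H r]: the rows of some matrix [A] with [r] rows form a Z-basis
   of [H]. *)
Definition has_rank (n : nat) (H : set 'rV[int]_n) (r : nat) : Prop :=
  exists A : 'M[int]_(r, n),
    H = [set c *m A | c in [set: 'rV[int]_r]] /\
    (forall c : 'rV[int]_r, c *m A = 0 -> c = 0).

(* Every subgroup of Z^n is free of finite rank and two bases have the same
   size, so the default value 0 is never used. *)
Definition lattice_rank (n : nat) (H : set 'rV[int]_n) : nat :=
  xget 0%N (has_rank H).

Definition Lplus (n : nat) (L : set 'rV[int]_n) : set 'rV[int]_n :=
  [set w | L w /\ forall i, 0 <= w 0 i].

Definition Lpure (n : nat) (L : set 'rV[int]_n) : set 'rV[int]_n :=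
  smallest (@is_lattice n) (Lplus L).

Definition sigma (n : nat) (L : set 'rV[int]_n) : set 'I_n :=
  [set i | exists2 w, Lplus L w & w 0 i != 0].

Definition expZ (n : nat) (u : 'X_{1..n}) : 'rV[int]_n :=
  \row_i (u i)%:Z.

(* u^sigma = (u_i)_{i notin sigma}, encoded as the exponent vector obtained
   from u by filling the coordinates in sigma with 0. *)
Definition restr_sigma (n : nat) (L : set 'rV[int]_n) (u : 'X_{1..n}) :
    'X_{1..n} :=
  [multinom (if i \in sigma L then 0%N else u i) | i < n].

(* Fibers; a monomial x^u is represented by its exponent vector u. *)

Definition fiber (n : nat) (L : set 'rV[int]_n) (u : 'X_{1..n}) :
    set 'X_{1..n} :=
  [set v | L (expZ v - expZ u)].

Definition is_fiber (n : nat) (L : set 'rV[int]_n) (F : set 'X_{1..n}) : Prop :=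
  exists u, F = fiber L u.

Definition mon_shift (n : nat) (u : 'X_{1..n}) (F : set 'X_{1..n}) :
    set 'X_{1..n} :=
  [set (u + w)%MM | w in F].

Definition fiber_le (n : nat) (F G : set 'X_{1..n}) : Prop :=
  exists u, mon_shift u F `<=` G.

Definition fiber_equiv (n : nat) (F G : set 'X_{1..n}) : Prop :=
  exists u v, mon_shift u F `<=` G /\ mon_shift v G `<=` F.

Definition fiber_class (n : nat) (L : set 'rV[int]_n) (F : set 'X_{1..n}) :
    set (set 'X_{1..n}) :=
  [set G | is_fiber L G /\ fiber_equiv F G].

Definition fiber_class_lt (n : nat) (L : set 'rV[int]_n)
    (F G : set 'X_{1..n}) : Prop :=
  fiber_le F G /\ fiber_class L F <> fiber_class L G.

(* Binomials and generating sets of the lattice ideal *)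

Definition is_binomial (k : fieldType) (n : nat) (B : {mpoly k[n]}) : Prop :=
  exists u v : 'X_{1..n}, u != v /\ B = 'X_[u] - 'X_[v].

Definition lattice_ideal (k : fieldType) (n : nat) (L : set 'rV[int]_n) :
    set {mpoly k[n]} :=
  ideal_gen [set B : {mpoly k[n]} | exists u v : 'X_{1..n},
    L (expZ u - expZ v) /\ B = 'X_[u] - 'X_[v]].

Arguments lattice_ideal k {n} L _.

Definition minimal_generating_set (k : fieldType) (n : nat)
    (L : set 'rV[int]_n) (S : set {mpoly k[n]}) : Prop :=
  S `<=` @is_binomial k n /\ minimal_system (lattice_ideal k L) S.

Definition cardinality_minimal (k : fieldType) (n : nat)
    (L : set 'rV[int]_n) (S : set {mpoly k[n]}) : Prop :=
  minimal_generating_set L S /\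
  (forall T : set {mpoly k[n]}, minimal_generating_set L T -> S #<= T).

(* By noetherianity cardinality-minimal generating sets exist and are finite,
   so the default value 0 is never used. *)
Definition mu (k : fieldType) (n : nat) (L : set 'rV[int]_n) : nat :=
  xget 0%N [set m | exists S : set {mpoly k[n]},
    cardinality_minimal L S /\ S #= `I_m].

(* [F] is the fiber F_B of the binomial [B] (meaningful for B in I_L). *)
Definition binomial_fiber (k : fieldType) (n : nat) (L : set 'rV[int]_n)
    (B : {mpoly k[n]}) (F : set 'X_{1..n}) : Prop :=
  exists u v : 'X_{1..n}, [/\ u != v, B = 'X_[u] - 'X_[v] & F = fiber L u].

Definition markov_fiber (k : fieldType) (n : nat) (L : set 'rV[int]_n)
    (F : set 'X_{1..n}) : Prop :=
  is_fiber L F /\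
  exists S : set {mpoly k[n]}, cardinality_minimal L S /\
  exists B, S B /\
  exists G, binomial_fiber L B G /\ fiber_class L G = fiber_class L F.

Definition lattice_ideal_lt (k : fieldType) (n : nat) (L : set 'rV[int]_n)
    (F : set 'X_{1..n}) : set {mpoly k[n]} :=
  ideal_gen [set B : {mpoly k[n]} |
    [/\ is_binomial B, lattice_ideal k L B
      & exists G, binomial_fiber L B G /\ fiber_class_lt L G F]].

(* The graph of a fiber *)

Definition monomial_ideal (k : fieldType) (n : nat) (F : set 'X_{1..n}) :
    set {mpoly k[n]} :=
  ideal_gen [set 'X_[u] | u in F].

Arguments monomial_ideal k {n} F _.

(* G(M_F), as a set of exponent vectors: the minimal system of monomial
   generators of M_F, which exists and is unique and finite. *)
Definition min_mon_gens (k : fieldType) (n : nat) (F : set 'X_{1..n}) :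
    set 'X_{1..n} :=
  xget set0 [set G : set 'X_{1..n} |
    minimal_system (monomial_ideal k F) [set 'X_[u] | u in G]].

Definition graph_vertices (k : fieldType) (n : nat) (L : set 'rV[int]_n)
    (F : set 'X_{1..n}) : {fset 'X_{1..n}} :=
  fset_set [set restr_sigma L u | u in min_mon_gens k F].

(* Loops are not excluded; they do not affect the connected components. *)
Definition graph_edge (k : fieldType) (n : nat) (L : set 'rV[int]_n)
    (F : set 'X_{1..n}) (a b : 'X_{1..n}) : Prop :=
  exists u v : 'X_{1..n},
    [/\ F u, F v, restr_sigma L u = a, restr_sigma L v = b
      & lattice_ideal_lt L F ('X_[u] - 'X_[v] : {mpoly k[n]})].

(* [n_comp e predT] is the number of connected components of the (symmetric)
   relation [e]. *)
Definition num_components (k : fieldType) (n : nat) (L : set 'rV[int]_n)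
    (F : set 'X_{1..n}) : nat :=
  n_comp (fun a b : graph_vertices k L F =>
            `[< graph_edge k L F (val a) (val b) >]) predT.

(* The graph does not depend on the representative of the class. *)
Definition t_class (k : fieldType) (n : nat) (L : set 'rV[int]_n)
    (C : set (set 'X_{1..n})) : nat :=
  num_components k L (xget set0 C).

Definition nontrivial_markov_classes (k : fieldType) (n : nat)
    (L : set 'rV[int]_n) : set (set (set 'X_{1..n})) :=
  [set fiber_class L F | F in markov_fiber k L]
    `\ fiber_class L (fiber L 0%MM).

(* Main.v *)
From mathcomp Require Import ssrcomplements.
Require Import Defs.

Set Implicit Arguments.
Unset Strict Implicit.
Unset Printing Implicit Defensive.

Import Order.TTheory GRing.Theory Num.Theory.

Local Open Scope classical_set_scope.
Local Open Scope card_scope.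
Local Open Scope ring_scope.

Local Notation class L u := (fiber_class L (fiber L u)).

(** Over any field, membership of a binomial x^u - x^v in an ideal generated by
    binomials x^a - x^b is a combinatorial matter: it holds exactly when u and v
    are related by the congruence of N^n generated by the pairs (a, b)
    ([ideal_binomialsP]). So a set of binomials generates I_L exactly when its
    exponent pairs generate the congruence u - v \in L, and the theorem becomes
    a count of the pairs needed, one class of fibers at a time.

    Call a monomial invertible when it divides a monomial of the fiber of 1.
    These are the monomials supported on sigma, they make up the fibers of the
    class of 1, and two equivalent fibers differ by invertible factors. Hence
    u |-> u^sigma is insensitive to the choice of a fiber in its class.
    On a fiber F it takes finitely many values, because they form an
    antichain; these values are the vertices of the graph of F.

    Lower bound. Let S generate, and let u, v lie in the same fiber F. A chain
    of moves from S joins u to v inside F. A move that uses a binomial of a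
    strictly smaller class stays in one component of the graph of F; a move
    that uses a binomial of the class of F multiplies it by an invertible
    monomial, hence joins the two vertices attached to that binomial. So the
    binomials of S in this class connect the components, and there are at least
    t - 1 of them ([generators_in_class]). In the class of 1, the differences of
    exponents of the binomials of S span L_pure, so there are at least
    rank(L_pure) of them ([generators_in_class0]).

    Upper bound. Choose rank(L_pure) nonnegative vectors b_i that generate
    L_pure, and take the pairs (b_i, 0); in every other class take a star of
    t - 1 pairs joining the components of the graph. These pairs generate
    ([fiber_cong_generated]): the (b_i, 0) identify any two monomials of F with
    the same restriction outside sigma and allow cancellation of invertible
    factors, the smaller classes are dealt with by induction on the degree
    outside sigma, and the star joins the remaining components.

    A finite generating set exists by Dickson's lemma and meets every class with
    t > 1, so the second family is finite. As the lower bound holds class by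
    class, a cardinality-minimal generating set has exactly t - 1 elements in
    each class other than that of 1; the classes of Markov fibers are therefore
    those with t > 1, besides possibly the class of 1. *)

(** * Binomial ideals and congruences on exponent vectors *)

Section IdealGen.
Variable R : comNzRingType.
Implicit Types (S : set R) (I : set R).

Lemma ideal_gen_is_ideal S : is_ideal (ideal_gen S).
Proof.
split.
- by move=> I [[]].
- by move=> x y Sx Sy I [idI SI]; case: (idI) => _ + _; apply; [apply: Sx|apply: Sy].
- by move=> a x Sx I [idI SI]; case: (idI) => _ _; apply; apply: Sx.
Qed.

Lemma ideal_gen_incl S : S `<=` ideal_gen S.
Proof. exact: sub_gen_smallest. Qed.

Lemma ideal_gen_min S I : is_ideal I -> S `<=` I -> ideal_gen S `<=` I.
Proof. exact: smallest_sub. Qed.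

Lemma ideal_opp I x : is_ideal I -> I x -> I (- x).
Proof. by move=> [_ _ MI] Ix; rewrite -mulN1r; apply: MI. Qed.

End IdealGen.

Section Congruence.
Variable n : nat.
Implicit Types (u v w c a b : 'X_{1..n}) (P Q : 'X_{1..n} -> 'X_{1..n} -> Prop).

Inductive cong P : 'X_{1..n} -> 'X_{1..n} -> Prop :=
| cong_step c a b of P a b : cong P (c + a)%MM (c + b)%MM
| cong_refl u : cong P u u
| cong_sym u v of cong P u v : cong P v u
| cong_trans v u w of cong P u v & cong P v w : cong P u w.

Lemma cong_gen P a b : P a b -> cong P a b.
Proof. by move=> Pab; rewrite -[a]add0m -[b]add0m; apply: cong_step. Qed.

Lemma cong_add P c u v : cong P u v -> cong P (c + u)%MM (c + v)%MM.
Proof.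
elim=> {u v} [d a b Pab|u|u v _ IH|v u w _ IH1 _ IH2].
- by rewrite !addmA; apply: cong_step.
- exact: cong_refl.
- exact: cong_sym.
- exact: cong_trans IH1 IH2.
Qed.

Lemma cong_sub P Q : (forall a b, P a b -> cong Q a b) ->
  forall u v, cong P u v -> cong Q u v.
Proof.
move=> PQ u v; elim=> {u v} [c a b Pab|u|u v _ IH|v u w _ IH1 _ IH2].
- by apply/cong_add/PQ.
- exact: cong_refl.
- exact: cong_sym.
- exact: cong_trans IH1 IH2.
Qed.

Variable k : fieldType.

Definition binomials P : set {mpoly k[n]} :=
  [set B | exists a b, P a b /\ B = 'X_[a] - 'X_[b]].

Let rep P u := xget 0%MM (cong P u).

Let rep_cong P u v : cong P u v <-> rep P u = rep P v.
Proof.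
have repP w : cong P w (rep P w) by apply: xgetPex; exists w; exact: cong_refl.
split=> [uv|ruv].
  rewrite /rep; congr xget; apply/seteqP; split=> w /= uw.
    exact: cong_trans (cong_sym uv) uw.
  exact: cong_trans uv uw.
by apply: cong_trans (repP u) _; rewrite ruv; apply: cong_sym.
Qed.

Let rho P (p : {mpoly k[n]}) : {mpoly k[n]} :=
  \sum_(m <- msupp p) p@_m *: 'X_[rep P m].

Let rhoE P p d : (msize p <= d)%N ->
  rho P p = \sum_(m : 'X_{1..n < d}) p@_m *: 'X_[rep P m].
Proof.
move=> le_pk; rewrite /rho (big_mksub 'X_{1..n < d}) ?msupp_uniq //=; first last.
  by move=> m mp; apply/(leq_trans _ le_pk)/msize_mdeg_lt.
by rewrite big_rmcond //= => i; move/memN_msupp_eq0 ->; rewrite scale0r.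
Qed.

Let rhoD P : {morph rho P : p q / p + q}.
Proof.
move=> p q; set d := (msize (p + q) + msize p + msize q)%N.
rewrite !(@rhoE P _ d) ?leq_addl // /d -?addnA ?leq_addr //; last first.
  by rewrite addnCA leq_addr.
by rewrite -big_split /=; apply: eq_bigr => m _; rewrite mcoeffD scalerDl.
Qed.

Let rho0 P : rho P 0 = 0.
Proof. by rewrite /rho msupp0 big_nil. Qed.

Let rhoZX P (c : k) m : rho P (c *: 'X_[m]) = c *: 'X_[rep P m].
Proof.
have [->|c0] := eqVneq c 0; first by rewrite !scale0r rho0.
by rewrite /rho msuppMCX // big_seq1 mcoeffZ mcoeffX eqxx mulr1.
Qed.

(** The linear map sending each monomial to a chosen representative of its
    congruence class kills the whole ideal, since it kills every multiple of
    each generator; this separates monomials of different classes. *)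
Lemma ideal_binomialsP P u v :
  ideal_gen (binomials P) ('X_[u] - 'X_[v]) <-> cong P u v.
Proof.
have idP := ideal_gen_is_ideal (binomials P); split.
  pose J := [set p : {mpoly k[n]} | forall a : {mpoly k[n]}, rho P (a * p) = 0].
  have idJ : is_ideal J.
    split=> [q|x y Jx Jy q|q x Jx r]; first by rewrite mulr0 rho0.
      by rewrite mulrDr rhoD Jx Jy addr0.
    by rewrite mulrA; apply: Jx.
  have PJ : binomials P `<=` J.
    move=> B [a [b [Pab ->]]] q; rewrite [q]mpolyE mulr_suml.
    rewrite (big_morph _ (rhoD P) (rho0 P)) big1_seq // => m _.
    rewrite -scalerAl mulrBr -!mpolyXD scalerBr -scaleNr rhoD !rhoZX.
    have /rep_cong -> : cong P (m + a)%MM (m + b)%MM by apply: cong_step.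
    by rewrite scaleNr subrr.
  move=> /(ideal_gen_min idJ PJ) /(_ 1).
  rewrite mul1r -[X in X - _]scale1r -scaleN1r rhoD !rhoZX => E.
  apply/rep_cong/eqP; apply/negP => /negP ne.
  move/(congr1 (mcoeff (rep P u))): E.
  rewrite mcoeffD !mcoeffZ !mcoeffX eqxx eq_sym (negPf ne) mulr0 addr0 mcoeff0.
  by move/eqP; rewrite mulr1 oner_eq0.
elim=> {u v} [c a b Pab|u|u v _ IH|v u w _ IH1 _ IH2].
- by rewrite !mpolyXD -mulrBr; case: idP => _ _; apply; apply: ideal_gen_incl; exists a, b.
- by rewrite subrr; case: idP.
- by rewrite -opprB; apply: (ideal_opp idP).
- by rewrite -(subrKA 'X_[v]); have [_ addI _] := idP; apply: addI.
Qed.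

End Congruence.

(** * Dickson's lemma *)

(** Pick repeatedly an index minimizing [h] among all later indices. *)
Lemma nondecreasing_subsequence (h : nat -> nat) :
  exists g : nat -> nat, {homo g : p q / (p < q)%N} /\
    {homo h \o g : p q / (p <= q)%N}.
Proof.
have /choice[nxt nxtP] m :
    exists j, (m <= j)%N /\ forall j', (m <= j')%N -> (h j <= h j')%N.
  have exh : exists v, `[< exists2 j, (m <= j)%N & h j = v >].
    by exists (h m); apply/asboolP; exists m.
  case: (ex_minnP exh) => v /asboolP[j mj <-] minv; exists j; split=> // j' mj'.
  by apply: minv; apply/asboolP; exists j'.
pose g := fix g p := if p is p'.+1 then nxt (g p').+1 else nxt 0%N.
exists g; split.
  apply: homo_ltn => [y x z|p]; first exact: ltn_trans.
  by case: (nxtP (g p).+1).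
apply: homo_leq => [//|y x z|p /=]; first exact: leq_trans.
have le_gS : (g p <= nxt (g p).+1)%N by case: (nxtP (g p).+1) => /ltnW.
case: p le_gS => [|p] le_gS; first by case: (nxtP 0%N) => _; apply.
have [le _] := nxtP (g p).+1; have [_] := nxtP (g p).+1; apply.
exact: leq_trans le le_gS.
Qed.

Lemma dickson_subsequence (I : eqType) (s : seq I) (f : nat -> I -> nat) :
  exists g : nat -> nat, {homo g : p q / (p < q)%N} /\
    forall i, i \in s -> {homo (fun p => f (g p) i) : p q / (p <= q)%N}.
Proof.
elim: s => [|i s [g [g_lt g_le]]]; first by exists id; split=> [p q|i]; rewrite ?in_nil.
have [h [h_lt h_le]] := nondecreasing_subsequence (fun p => f (g p) i).
exists (g \o h); split=> [p q pq|j]; first by apply: g_lt; apply: h_lt.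
rewrite in_cons => /predU1P[->|js] p q pq; first exact: h_le.
by apply: g_le => //; apply: (ltnW_homo h_lt).
Qed.

(** An infinite antichain would give an injective sequence with a subsequence
    nondecreasing in every coordinate. The vectors are given through [f] so as
    to apply to exponent vectors and to pairs of them alike. *)
Lemma dickson (I : finType) (T : Type) (f : T -> I -> nat) (A : set T) :
  (forall x y, A x -> A y -> (forall i, (f x i <= f y i)%N) -> x = y) ->
  finite_set A.
Proof.
move=> antiA; apply: contrapT => /infiniteP/card_leP/injfunPex[s0 _ s0_inj].
pose s (p : nat) : T := set_val (s0 (exist _ p (mem_set (Logic.I : setT p)))).
have sA p : A (s p) by apply/set_mem/(valP (s0 _)).
have s_inj : injective s.
  move=> p q /val_inj/s0_inj => /(_ (mem_set Logic.I) (mem_set Logic.I)).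
  by move=> /(congr1 set_val).
have [g [g_lt g_le]] := dickson_subsequence (enum I) (fun p => f (s p)).
have /s_inj E : s (g 0%N) = s (g 1%N).
  by apply: antiA => [||i]; try exact: sA; apply: g_le; rewrite ?mem_enum.
by have := g_lt 0%N 1%N isT; rewrite E ltnn.
Qed.

(** * Exponent vectors and lattices *)
Section Exponents.
Variable n : nat.
Implicit Types (u v c : 'X_{1..n}) (w : 'rV[int]_n).

Lemma expZD u v : expZ (u + v)%MM = expZ u + expZ v.
Proof. by apply/rowP => i; rewrite !mxE mnmDE PoszD. Qed.

Lemma expZ0 : expZ (0%MM : 'X_{1..n}) = 0.
Proof. by apply/rowP => i; rewrite !mxE mnm0E. Qed.

Lemma expZB u v : (u <= v)%MM -> expZ (v - u)%MM = expZ v - expZ u.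
Proof. by move=> uv; rewrite -[in RHS](submK uv) expZD addrK. Qed.

Lemma expZMn u d : expZ (u *+ d)%MM = expZ u *+ d.
Proof.
elim: d => [|d IH]; first by rewrite mulm0n mulr0n expZ0.
by rewrite mulmS mulrS expZD IH.
Qed.

(** A bound uniform in [i], so that one multiple of [v] dominates [u] on the
    whole support of [v]. *)
Lemma leq_mulm_mdeg u v i : v i != 0%N -> (u i <= (v *+ mdeg u)%MM i)%N.
Proof.
rewrite -lt0n mulmnE mdegE (bigD1 i) //= => vi.
by apply: leq_trans (leq_pmull _ vi); apply: leq_addr.
Qed.

Definition pos_part w : 'X_{1..n} :=
  [multinom (if (0 <= w 0 i)%R then `|(w 0 i)%R|%N else 0%N) | i < n].

Lemma expZ_pos_part w : (forall i, 0 <= w 0 i) -> expZ (pos_part w) = w.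
Proof.
by move=> w0; apply/rowP => i; rewrite mxE mnmE w0 gez0_abs.
Qed.

Lemma pos_partB w : w = expZ (pos_part w) - expZ (pos_part (- w)).
Proof.
apply/rowP => i; rewrite !mxE !mnmE !mxE oppr_ge0.
case: ltrgt0P => wi.
- by rewrite subr0 gtz0_abs.
- by rewrite sub0r abszN ltz0_abs ?opprK.
- by rewrite wi.
Qed.

End Exponents.

Section Lattice.
Variables (n : nat) (L : set 'rV[int]_n).
Hypothesis HL : is_lattice L.
Implicit Types (u v w c : 'X_{1..n}).

Lemma lattice0 : L 0. Proof. by case: HL. Qed.

Lemma latticeB x y : L x -> L y -> L (x - y).
Proof. by case: HL => _; apply. Qed.

Lemma latticeN x : L x -> L (- x).
Proof. by move=> Lx; rewrite -sub0r; apply: latticeB => //; apply: lattice0. Qed.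

Lemma latticeD x y : L x -> L y -> L (x + y).
Proof. by move=> Lx Ly; rewrite -[y]opprK; apply/latticeB/latticeN. Qed.

Lemma latticeMn x d : L x -> L (x *+ d).
Proof.
move=> Lx; elim: d => [|d IH]; first by rewrite mulr0n; apply: lattice0.
by rewrite mulrS; apply: latticeD.
Qed.

Lemma latticeMz x (z : int) : L x -> L (x *~ z).
Proof.
by move=> Lx; case: z => d; rewrite ?NegzE ?mulrNz; [|apply: latticeN]; apply: latticeMn.
Qed.

Lemma lattice_sum (I : Type) (r : seq I) (F : I -> 'rV[int]_n) :
  (forall i, L (F i)) -> L (\sum_(i <- r) F i).
Proof.
move=> LF; elim: r => [|i r IH]; first by rewrite big_nil; apply: lattice0.
by rewrite big_cons; apply: latticeD.
Qed.

(** * Fibers and their preorder *)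

Lemma fiber_refl u : fiber L u u.
Proof. by rewrite /fiber /= subrr; apply: lattice0. Qed.

Lemma fiber_sym u v : fiber L u v -> fiber L v u.
Proof. by rewrite /fiber /= => /latticeN; rewrite opprB. Qed.

Lemma fiber_trans v u w : fiber L u v -> fiber L v w -> fiber L u w.
Proof. by rewrite /fiber /= => uv vw; rewrite -(subrKA (expZ v)); apply: latticeD. Qed.

Lemma fiber_eq u v : fiber L u v -> fiber L u = fiber L v.
Proof.
move=> uv; apply/seteqP; split=> w; apply: fiber_trans => //.
exact: fiber_sym.
Qed.

Lemma fiber_add c u v : fiber L (c + u)%MM (c + v)%MM = fiber L u v.
Proof. by rewrite /fiber /= !expZD opprD addrACA subrr add0r. Qed.

Lemma fiber_cong u v : cong (fiber L) u v <-> fiber L u v.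
Proof.
split=> [|uv]; last exact: cong_gen.
elim=> {u v} [c a b|u|u v _|v u w _ + _].
- by rewrite fiber_add.
- exact: fiber_refl.
- exact: fiber_sym.
- exact: fiber_trans.
Qed.

(** The order on classes of fibers, read on one exponent vector of each fiber. *)
Definition exp_le u v := exists c, fiber L v (c + u)%MM.

Lemma exp_le_trans v u w : exp_le u v -> exp_le v w -> exp_le u w.
Proof.
move=> [c vcu] [d wdv]; exists (d + c)%MM; apply: fiber_trans wdv _.
by rewrite -addmA fiber_add.
Qed.

Lemma fiber_exp_le u v : fiber L u v -> exp_le u v.
Proof. by move=> uv; exists 0%MM; rewrite add0m; apply: fiber_sym. Qed.

Lemma exp_le0 u : exp_le 0%MM u.
Proof. by exists u; rewrite addm0; apply: fiber_refl. Qed.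

Lemma fiber_leP u v : fiber_le (fiber L u) (fiber L v) <-> exp_le u v.
Proof.
split=> [[c cuv]|[c vcu]]; exists c; first by apply: cuv; exists u => //; apply: fiber_refl.
by move=> _ [w uw <-]; apply: fiber_trans vcu _; rewrite fiber_add.
Qed.

Lemma fiber_equivP u v :
  fiber_equiv (fiber L u) (fiber L v) <-> exp_le u v /\ exp_le v u.
Proof.
split=> [[c [d [cuv dvu]]]|[/fiber_leP[c cuv] /fiber_leP[d dvu]]].
  by split; apply/fiber_leP; [exists c|exists d].
by exists c, d.
Qed.

Lemma fiber_class_eqP u v :
  class L u = class L v <-> exp_le u v /\ exp_le v u.
Proof.
split=> [E|[uv vu]].
  have : fiber_class L (fiber L v) (fiber L v).
    split; first by exists v.
    by apply/fiber_equivP; split; apply/fiber_exp_le/fiber_refl.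
  by rewrite -E => -[_ /fiber_equivP].
apply/seteqP; split=> _ [[w ->] /fiber_equivP[le1 le2]]; split; try by exists w.
  by apply/fiber_equivP; split; [apply: exp_le_trans vu le1|apply: exp_le_trans le2 uv].
by apply/fiber_equivP; split; [apply: exp_le_trans uv le1|apply: exp_le_trans le2 vu].
Qed.

Lemma fiber_class_ltP u v :
  fiber_class_lt L (fiber L u) (fiber L v) <-> exp_le u v /\ ~ exp_le v u.
Proof.
split=> [[/fiber_leP uv ne]|[uv nvu]]; split=> //; try exact/fiber_leP.
  by move=> vu; apply/ne/fiber_class_eqP.
by move/fiber_class_eqP=> [].
Qed.

(** * Monomials invertible modulo the lattice ideal *)

(** x^c x^d is congruent to 1 modulo I_L. *)
Definition invertible_mon c := exists d, L (expZ (c + d)%MM).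

Lemma invertible_monP c : invertible_mon c <-> exp_le c 0%MM.
Proof.
by split=> -[d]; rewrite /= ?/fiber /= ?expZ0 ?subr0 => Ld; exists d;
  rewrite /fiber /= ?expZ0 ?subr0 addmC.
Qed.

(** Going from one fiber to an equivalent one and back multiplies by a
    monomial of the fiber of 1, of which x^c is a factor. *)
Lemma invertible_of_equiv c u v : fiber L v (c + u)%MM -> exp_le v u -> invertible_mon c.
Proof.
move=> vcu [d udv]; exists d.
have : fiber L u (d + c + u)%MM.
  by apply: fiber_trans udv _; rewrite -addmA fiber_add.
by rewrite /fiber /= expZD addrK addmC.
Qed.

Lemma exp_le_invertible c u : invertible_mon c -> exp_le (c + u)%MM u.
Proof.
move=> [d Lcd]; exists d; rewrite addmA.
by rewrite /fiber /= expZD addrK addmC.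
Qed.

Lemma equiv_translate u v : exp_le u v -> exp_le v u ->
  exists2 c, invertible_mon c & fiber L v (c + u)%MM.
Proof. by move=> [c vcu] vu; exists c => //; apply: invertible_of_equiv vu. Qed.

Lemma invertible_sigma c i : invertible_mon c -> c i != 0%N -> sigma L i.
Proof.
move=> [d Lcd] ci; exists (expZ (c + d)%MM); last first.
  by rewrite mxE mnmDE eqz_nat addn_eq0 (negPf ci).
by split=> // j; rewrite mxE.
Qed.

(** Sum up one element of L^+ for each coordinate in sigma. *)
Lemma full_support_element :
  exists p : 'X_{1..n}, L (expZ p) /\ forall i, sigma L i -> p i != 0%N.
Proof.
suff [p [Lp pP]] : exists p : 'X_{1..n},
    L (expZ p) /\ forall i, i \in enum 'I_n -> sigma L i -> p i != 0%N.
  by exists p; split=> // i; apply: pP; rewrite mem_enum.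
elim: (enum 'I_n) => [|i s [p [Lp pP]]].
  by exists 0%MM; split=> //; rewrite expZ0; apply: lattice0.
have [[w [Lw w0] wi]|nsi] := pselect (sigma L i); last first.
  by exists p; split=> // j; rewrite in_cons => /predU1P[->|] //; apply: pP.
exists (pos_part w + p)%MM; split.
  by rewrite expZD expZ_pos_part //; apply: latticeD.
move=> j; rewrite in_cons mnmDE addn_eq0 => /predU1P[-> _|js sj].
  by rewrite mnmE w0 absz_eq0 (negPf wi).
by rewrite (negPf (pP j js sj)) andbF.
Qed.

Lemma invertible_supp c : (forall i, c i != 0%N -> sigma L i) -> invertible_mon c.
Proof.
move=> cs; have [p [Lp pP]] := full_support_element.
have cp : (c <= p *+ mdeg c)%MM.
  apply/mnm_lepP => i.
  have [->//|ci] := eqVneq (c i) 0%N.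
  exact/leq_mulm_mdeg/pP/cs.
by exists (p *+ mdeg c - c)%MM; rewrite addmC submK // expZMn; apply: latticeMn.
Qed.

Notation rs := (restr_sigma L).

Lemma restr_addl c u : invertible_mon c -> rs (c + u)%MM = rs u.
Proof.
move=> c1; apply/mnmP => i; rewrite !mnmE; case: ifPn => // ni.
case: (eqVneq (c i) 0%N) => [->//|ci].
by case/negP: ni; apply/mem_set; apply: invertible_sigma ci.
Qed.

(** The complementary factor of [restr_sigma L u] in [u]. *)
Definition sigma_part u : 'X_{1..n} := (u - rs u)%MM.

Lemma sigma_partK u : (sigma_part u + rs u)%MM = u.
Proof.
by apply: submK; apply/mnm_lepP => i; rewrite mnmE; case: ifP.
Qed.

Lemma sigma_part_invertible u : invertible_mon (sigma_part u).
Proof.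
apply: invertible_supp => i; rewrite mnmE mnmE; case: ifPn; last by rewrite subnn.
by rewrite inE.
Qed.

(** If v - u is nonnegative outside sigma, adding a large multiple of a vector of
    L^+ with full support makes it an element of L^+; its support then lies in
    sigma. *)
Lemma restr_antichain u v : fiber L u v -> (rs u <= rs v)%MM -> rs u = rs v.
Proof.
move=> uv /mnm_lepP ruv; have [p [Lp pP]] := full_support_element.
set q := (v + p *+ mdeg u)%MM.
have uq : (u <= q)%MM.
  apply/mnm_lepP => i; rewrite mnmDE.
  have [/set_mem si|nsi] := boolP (i \in sigma L); last first.
    by have := ruv i; rewrite !mnmE (negPf nsi) => /leq_trans; apply; rewrite leq_addr.
  apply: leq_trans (leq_addl _ _).
  exact/leq_mulm_mdeg/pP.
have qu1 : invertible_mon (q - u)%MM.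
  exists 0%MM; rewrite addm0 expZB // expZD addrAC expZMn.
  by apply: latticeD => //; apply: latticeMn.
have pu1 : invertible_mon (p *+ mdeg u)%MM.
  by exists 0%MM; rewrite addm0 expZMn; apply: latticeMn.
by rewrite -(restr_addl v pu1) addmC -/q -(submK uq) restr_addl.
Qed.

Lemma finite_restr_fiber u : finite_set [set rs v | v in fiber L u].
Proof.
apply: (@dickson 'I_n _ (fun (x : 'X_{1..n}) i => x i)) => _ _ [v uv <-] [w uw <-] vw.
apply: restr_antichain; first exact: fiber_trans (fiber_sym uv) uw.
exact/mnm_lepP.
Qed.

End Lattice.

(** * Minimal monomial generators of a fiber *)
Section MonomialIdeal.
Variables (k : fieldType) (n : nat).
Implicit Types (u v : 'X_{1..n}) (F G : set 'X_{1..n}).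

Notation monomials G := [set ('X_[u] : {mpoly k[n]}) | u in G].

Lemma mpolyX_inj : injective (fun u : 'X_{1..n} => 'X_[u] : {mpoly k[n]}).
Proof.
move=> u v /(congr1 (mcoeff u)); rewrite !mcoeffX eqxx.
by case: eqVneq => // _ /eqP; rewrite oner_eq0.
Qed.

(** Polynomials all of whose monomials are divisible by an element of [F] form
    an ideal. *)
Lemma monomial_idealP F u :
  monomial_ideal k F 'X_[u] <-> exists2 g, F g & (g <= u)%MM.
Proof.
split=> [|[g Fg gu]]; last first.
  have [_ _] := ideal_gen_is_ideal (monomials F).
  move=> /(_ 'X_[u - g] 'X_[g]); rewrite -mpolyXD submK //; apply.
  by apply: ideal_gen_incl; exists g.
pose J := [set p : {mpoly k[n]} |
  forall m, m \in msupp p -> exists2 g, F g & (g <= m)%MM].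
have idJ : is_ideal J.
  split=> [m|p q Jp Jq m|a p Jp m]; first by rewrite msupp0.
    by move/msuppD_le; rewrite mem_cat => /orP[/Jp|/Jq].
  move/msuppM_le => /allpairsP[[m1 m2] /= [_ /Jp[g Fg gm] ->]].
  by exists g => //; apply: lepm_trans gm (lem_addl _ _).
have FJ : monomials F `<=` J.
  move=> _ [g Fg <-] m; rewrite msuppX inE => /eqP ->.
  by exists g => //; apply: lepm_refl.
move=> /(ideal_gen_min idJ FJ) /(_ u); rewrite msuppX inE; exact.
Qed.

Lemma lepm_anti u v : (u <= v)%MM -> (v <= u)%MM -> u = v.
Proof.
move=> /mnm_lepP uv /mnm_lepP vu; apply/mnmP => i.
by apply/eqP; rewrite eqn_leq uv vu.
Qed.

Lemma exists_minimal_divisor F u : F u ->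
  exists g, [/\ F g, (g <= u)%MM & forall v, F v -> (v <= g)%MM -> v = g].
Proof.
elim: (mdeg u) {-2}u (leqnn (mdeg u)) => {u} [|d IH] u ud Fu.
  exists u; split=> // [|v Fv vu]; first exact: lepm_refl.
  have u0 : u = 0%MM by apply/eqP; rewrite -mdeg_eq0 -leqn0.
  apply: lepm_anti => //; rewrite u0; apply/mnm_lepP => i.
  by rewrite mnm0E.
have [[v [Fv vu nvu]]|nv] :=
    pselect (exists v, [/\ F v, (v <= u)%MM & v <> u]); last first.
  exists u; split=> // [|v Fv vu]; first exact: lepm_refl.
  by apply: contrapT => nvu; apply: nv; exists v.
have vd : (mdeg v <= d)%N.
  rewrite -ltnS; apply: leq_trans ud; rewrite -(submK vu) mdegD.
  rewrite -[X in (X < _)%N]add0n ltn_add2r lt0n mdeg_eq0.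
  by apply/eqP => E; apply: nvu; rewrite -(submK vu) E add0m.
have [g [Fg gv ming]] := IH v vd Fv.
by exists g; split=> //; apply: lepm_trans gv vu.
Qed.

Lemma ideal_gen_monomials_sub F G :
  (forall u, F u -> exists2 g, G g & (g <= u)%MM) ->
  ideal_gen (monomials F) `<=` ideal_gen (monomials G).
Proof.
move=> FG; apply: ideal_gen_min; first exact: ideal_gen_is_ideal.
by move=> _ [u Fu <-]; apply/monomial_idealP/FG.
Qed.

Lemma minimal_system_exists F :
  exists G, minimal_system (monomial_ideal k F) (monomials G).
Proof.
exists [set g | F g /\ forall v, F v -> (v <= g)%MM -> v = g]; split.
  apply/seteqP; split; apply: ideal_gen_monomials_sub => u.
    by move=> [Fu _]; exists u => //; apply: lepm_refl.
  by move=> /exists_minimal_divisor[g [Fg gu ming]]; exists g.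
move=> T TG TF; apply/seteqP; split=> // _ [g [Fg ming] <-].
have : monomial_ideal k F 'X_[g] by apply: ideal_gen_incl; exists g.
have -> : monomial_ideal k F = monomial_ideal k [set u | T 'X_[u]].
  rewrite -TF /monomial_ideal; congr ideal_gen; apply/seteqP.
  split=> [B TB|_ [u Tu <-]//].
  by have [u _ uB] := TG B TB; exists u => //=; rewrite uB.
move=> /monomial_idealP[u /= Tu ug].
by have [v [Fv _] /mpolyX_inj vu] := TG _ Tu; rewrite -(ming u) // -vu.
Qed.

(** The two properties of G(M_F) from which the vertices of the graph are
    computed. A minimal generator is divisible by some f in [F], itself divisible by
    a minimal generator, and minimality makes the three equal. *)
Lemma min_mon_gensP F (G := min_mon_gens k F) :
  G `<=` F /\ forall u, F u -> exists2 g, G g & (g <= u)%MM.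
Proof.
have [GF minG] : minimal_system (monomial_ideal k F) (monomials G).
  exact: xgetPex (minimal_system_exists F).
have FG u : F u -> exists2 g, G g & (g <= u)%MM.
  by move=> Fu; apply/monomial_idealP; rewrite /monomial_ideal GF;
    apply: ideal_gen_incl; exists u.
split=> // g Gg.
have [f Ff fg] : exists2 f, F f & (f <= g)%MM.
  apply/monomial_idealP; rewrite -GF; apply: ideal_gen_incl.
  by exists g.
have [g' Gg' g'f] := FG f Ff.
suff g'g : g' = g by rewrite -(lepm_anti fg) // -g'g.
apply: contrapT => ne.
have /seteqP[_ /(_ 'X_[g])] : monomials (G `\ g) = monomials G.
  apply: minG => [_ [u [Gu _] <-]|]; first by exists u.
  rewrite -GF; apply/seteqP; split; apply: ideal_gen_monomials_sub => u.
    by move=> [Gu _]; exists u => //; apply: lepm_refl.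
  have [-> _|ug Gu] := pselect (u = g); last first.
    by exists u; [split|apply: lepm_refl].
  by exists g'; [split|apply: lepm_trans g'f fg].
by case=> [|u [_ ug] /mpolyX_inj //]; exists g.
Qed.

End MonomialIdeal.

(** * Binomials in the lattice ideal and in its lower parts *)
Section LatticeIdeals.
Variables (k : fieldType) (n : nat) (L : set 'rV[int]_n).
Hypothesis HL : is_lattice L.
Implicit Types (u v w : 'X_{1..n}).

(** Minimal generators suffice to describe the vertices, but all of [F] gives the
    same restrictions: a minimal generator g dividing u in [F] has
    g^sigma <= u^sigma, and restrictions of elements of [F] form an
    antichain. *)
Lemma graph_verticesP w a :
  (a \in graph_vertices k L (fiber L w)) <->
  exists2 u, fiber L w u & restr_sigma L u = a.
Proof.
have [GF FG] := min_mon_gensP k (fiber L w).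
have E : [set restr_sigma L u | u in min_mon_gens k (fiber L w)] =
    [set restr_sigma L u | u in fiber L w].
  apply/seteqP; split=> _ [u Hu <-]; first by exists u => //; apply: GF.
  have [g Gg gu] := FG u Hu; exists g => //.
  apply: restr_antichain => //; first exact: fiber_trans (fiber_sym HL (GF _ Gg)) Hu.
  apply/mnm_lepP => i; rewrite !mnmE; case: ifP => // _.
  exact: (mnm_lepP gu).
rewrite /graph_vertices E in_fset_set; last exact: finite_restr_fiber.
by rewrite inE.
Qed.

Lemma lattice_idealP u v : lattice_ideal k L ('X_[u] - 'X_[v]) <-> fiber L u v.
Proof.
rewrite -(fiber_cong HL).
apply: (iff_trans (ideal_binomialsP k (fun u v => L (expZ u - expZ v)) u v)).
by split; apply: cong_sub => a b Lab; apply: cong_gen; apply: fiber_sym.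
Qed.

(** In characteristic 2 the order of the two monomials is lost, hence the
    disjunction. *)
Lemma binomial_inj u v u' v' : u != v ->
  'X_[u] - 'X_[v] = 'X_[u'] - 'X_[v'] :> {mpoly k[n]} -> u = u' \/ u = v'.
Proof.
move=> /negPf uv /(congr1 (mcoeff u)); rewrite !mcoeffB !mcoeffX eqxx.
rewrite [v == u]eq_sym uv subr0 ![_ == u]eq_sym.
case: eqVneq => [|_]; first by left.
case: eqVneq => [|_]; first by right.
by rewrite subr0 => /eqP; rewrite oner_eq0.
Qed.

(** Exponent pairs of the generators of I_{L,<F}, for F the fiber of [w]; the
    pairs u = v are allowed, as they are harmless in a congruence. *)
Definition lower_pairs w u v := fiber L u v /\ (exp_le L u w /\ ~ exp_le L w u).

Lemma lattice_ideal_ltP w u v :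
  lattice_ideal_lt L (fiber L w) ('X_[u] - 'X_[v] : {mpoly k[n]}) <->
  cong (lower_pairs w) u v.
Proof.
rewrite /lattice_ideal_lt; set S := [set B | _].
have -> : S = binomials (fun u v => u != v /\ lower_pairs w u v).
  apply/seteqP; split=> [B|_ [a [b [[ab [Lab lt]] ->]]]].
    move=> [_ IB [_ [[a [b [ab EB ->]] /(fiber_class_ltP HL)lt]]]].
    exists a, b; split=> //; split=> //; split=> //.
    by apply/lattice_idealP; rewrite -EB.
  split; [by exists a, b|exact/lattice_idealP|].
  by exists (fiber L a); split; [exists a, b|apply/fiber_class_ltP].
apply: (iff_trans (ideal_binomialsP _ _ _ _)).
split; apply: cong_sub => a b; first by move=> [_ H]; apply: cong_gen.
by have [-> _|ab H] := eqVneq a b; [apply: cong_refl|apply: cong_gen].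
Qed.

End LatticeIdeals.

(** * Counting connected components *)
Definition equiv_rel (T : Type) (K : T -> T -> Prop) :=
  [/\ forall x, K x x, forall x y, K x y -> K y x
    & forall y x z, K x y -> K y z -> K x z].

Section Components.
Variable V : finType.
Implicit Types (h : V -> V) (K : V -> V -> Prop).

(** Adding one edge merges at most two components. The components are encoded
    as the fibers of [h], so that merging those of x and y amounts to replacing
    the value h y by h x; no graph has to be updated. *)
Lemma card_codom_le h (s : seq (V * V)) :
  (forall K, equiv_rel K -> (forall a b, h a = h b -> K a b) ->
     (forall p, p \in s -> K p.1 p.2) -> forall a b, K a b) ->
  (#|codom h| <= (size s).+1)%N.
Proof.
elim: s h => [|[x y] s IH] h total.
  apply/card_le1P => a /codomP[x ->] b; rewrite inE.
  apply/codomP/eqP => [[y ->]|->]; last by exists x.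
  apply: (total (fun a b => h a = h b)) => //; split=> // ? ? ? -> //.
pose h' a := if h a == h y then h x else h a.
apply: (@leq_trans (#|codom h'|).+1).
  apply: (@leq_trans #|[predU1 h y & codom h']|); last first.
    by rewrite cardU1; case: (_ \notin _) => //=; rewrite add0n.
  apply/subset_leq_card/fintype.subsetP => _ /codomP[a ->]; rewrite inE.
  have [//|ne] := eqVneq (h a) (h y); rewrite orbC.
  by apply/orP; left; apply/codomP; exists a; rewrite /h' (negPf ne).
rewrite ltnS; apply: IH => K eqK hK sK; apply: total => // [a b hab|p].
  by apply: hK; rewrite /h' hab.
rewrite in_cons => /predU1P[->/=|]; last exact: sK.
by apply: hK; rewrite /h' eqxx; case: ifP => // /eqP.
Qed.

Variable e : rel V.

Lemma connect_equiv K : equiv_rel K -> (forall a b, e a b -> K a b) ->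
  forall a b, connect e a b -> K a b.
Proof.
move=> [Kr _ Kt] eK a b /connectP[p + ->].
elim: p a => [|c p IH] a /=; first by move=> _; apply: Kr.
by move=> /andP[/eK ac /IH]; apply: Kt.
Qed.

Hypothesis e_sym : ssrbool.symmetric e.

(** The connectivity hypothesis is stated through all equivalence relations that
    contain the edges: this is the form in which a generating set of a congruence
    supplies it. *)
Lemma n_comp_le (s : seq (V * V)) :
  (forall K, equiv_rel K -> (forall a b, e a b -> K a b) ->
     (forall p, p \in s -> K p.1 p.2) -> forall a b, K a b) ->
  (n_comp e predT <= (size s).+1)%N.
Proof.
move=> total; have esym := sym_connect_sym e_sym.
rewrite /n_comp_mem; apply: (@leq_trans #|codom (fingraph.root e)|); last apply: card_codom_le.
  apply/subset_leq_card/fintype.subsetP => a; rewrite !inE => /andP[/eqP <- _].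
  exact: codom_f.
move=> K eqK rK sK; apply: total => // a b eab; apply: rK.
by apply/(fingraph.rootP esym)/connect1.
Qed.

Lemma n_comp_spanning_star (v0 : V) :
  exists (r0 : V) (rs : seq V), size rs = (n_comp e predT - 1)%N /\
  forall K, equiv_rel K -> (forall a b, e a b -> K a b) ->
    (forall r, r \in rs -> K r0 r) -> forall a b, K a b.
Proof.
have esym := sym_connect_sym e_sym.
have rootsP a : fingraph.root e a \in roots e by exact: roots_root.
exists (fingraph.root e v0), (filter (predC1 (fingraph.root e v0)) (enum (roots e))); split.
  rewrite size_filter -[X in (X - 1)%N](_ : size (enum (roots e)) = _); last first.
    by rewrite -cardE; apply: eq_card => a; rewrite !inE andbT.
  rewrite -(count_predC (pred1 (fingraph.root e v0))) count_uniq_mem ?enum_uniq //.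
  by rewrite mem_enum rootsP // addKn.
move=> K eqK eK rK; have [Kr Ks Kt] := eqK.
suff K0 a : K (fingraph.root e v0) a by move=> a b; apply: (Kt (fingraph.root e v0)) => //; apply: Ks.
apply: (Kt (fingraph.root e a)); last first.
  by apply: Ks; apply: connect_equiv (connect_root e a).
have [->//|ne] := eqVneq (fingraph.root e a) (fingraph.root e v0).
by apply: rK; rewrite mem_filter /= ne mem_enum rootsP.
Qed.

End Components.

(** * The graph of a fiber *)
Section FiberGraph.
Variables (k : fieldType) (n : nat) (L : set 'rV[int]_n).
Hypothesis HL : is_lattice L.
Implicit Types (u v w : 'X_{1..n}).

Notation rs := (restr_sigma L).

Definition same_class w u := exp_le L u w /\ exp_le L w u.

Lemma graph_edgeP w a b : graph_edge k L (fiber L w) a b <->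
  exists u v, [/\ fiber L w u, fiber L w v, rs u = a, rs v = b
    & cong (lower_pairs L w) u v].
Proof.
by split=> -[u [v [wu wv ua vb E]]]; exists u, v; split=> //;
  apply/(lattice_ideal_ltP k HL).
Qed.

Lemma graph_edge_sym w :
  ssrbool.symmetric (fun a b : graph_vertices k L (fiber L w) =>
    `[< graph_edge k L (fiber L w) (val a) (val b) >]).
Proof.
move=> a b; apply: asbool_equiv_eq; split=> /graph_edgeP[u [v [wu wv ua vb E]]];
  by apply/graph_edgeP; exists v, u; split=> //; apply: cong_sym.
Qed.

Lemma fiber_vertex w u : fiber L w u -> rs u \in graph_vertices k L (fiber L w).
Proof. by move=> wu; apply/(graph_verticesP k HL); exists u. Qed.

(** Along a chain of moves inside the fiber, a move c + a -> c + b either uses a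
    pair of a strictly smaller class, and follows an edge of the graph, or has
    c invertible, and then joins the vertices of a and b. *)
Lemma num_components_le w (ps : seq ('X_{1..n} * 'X_{1..n})) :
  (forall p, p \in ps -> fiber L p.1 p.2) ->
  (forall u v, fiber L u v -> cong (fun a b => (a, b) \in ps) u v) ->
  (num_components k L (fiber L w) <=
     (count (fun p => `[< same_class w p.1 >]) ps).+1)%N.
Proof.
move=> psL Lps; rewrite -size_filter; set qs := filter _ _.
pose vw := [` fiber_vertex (fiber_refl HL w)]%fset.
pose phi u := insubd vw (rs u).
have phiE u : fiber L w u -> val (phi u) = rs u.
  by move=> wu; rewrite /phi val_insubd fiber_vertex.
rewrite -(size_map (fun p => (phi p.1, phi p.2)) qs).
apply: n_comp_le; first exact: graph_edge_sym.
move=> K [Kr Ks Kt] eK qK a b.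
have [[u wu ua] [v wv vb]] := ((graph_verticesP k HL w _).1 (valP a),
  (graph_verticesP k HL w _).1 (valP b)).
have -> : a = phi u by apply: val_inj; rewrite phiE.
have -> : b = phi v by apply: val_inj; rewrite phiE.
have {a b ua vb} := Lps u v (fiber_trans HL (fiber_sym HL wu) wv).
suff H u' v' : cong (fun a b => (a, b) \in ps) u' v' ->
    (fiber L w u' -> K (phi u') (phi v')) by move/H; apply.
have ps_fiber x y : cong (fun a b => (a, b) \in ps) x y -> fiber L x y.
  by move=> xy; apply/(fiber_cong HL); apply: cong_sub xy => a b /psL /=;
    apply: cong_gen.
elim=> {u v wu wv u' v'} [c a b ab wca|u _|u v uv IH wv|v u w' uv IH1 vw' IH2 wu].
- have Lab := psL _ ab; have wcb : fiber L w (c + b)%MM.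
    by apply: fiber_trans wca _ => //; rewrite fiber_add.
  (* exp_le L a w holds already, through c *)
  have [le|nle] := pselect (exp_le L w a).
    have c1 : invertible_mon L c by apply: invertible_of_equiv wca le.
    have E x : fiber L w (c + x)%MM -> phi (c + x)%MM = phi x.
      by move=> wx; rewrite /phi restr_addl.
    rewrite !E //; apply: (qK (phi a, phi b)).
    apply/mapP; exists (a, b) => //; rewrite mem_filter ab andbT.
    by apply/asboolP; split=> //; exists c.
  apply: eK; apply/asboolP/graph_edgeP; exists (c + a)%MM, (c + b)%MM.
  split=> //; rewrite ?phiE //; apply: cong_step; split=> //; split=> //.
  by exists c.
- exact: Kr.
- apply: Ks; apply: IH; apply: fiber_trans wv _ => //.
  by apply: fiber_sym => //; apply: ps_fiber.
- apply: Kt (IH1 wu) (IH2 _); apply: fiber_trans wu _ => //.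
  exact: ps_fiber.
Qed.

(** The star on the components, lifted to pairs of monomials of the fiber. The
    three hypotheses on [Q] list what connects two monomials: equal
    restrictions, the ideal I_{L,<F}, and the chosen pairs. *)
Lemma fiber_spanning_pairs w :
  exists ps : seq ('X_{1..n} * 'X_{1..n}),
  [/\ size ps = (num_components k L (fiber L w) - 1)%N,
    forall p, p \in ps -> fiber L w p.1 /\ fiber L w p.2
    & forall Q, equiv_rel Q ->
      (forall u v, fiber L w u -> fiber L w v -> rs u = rs v -> Q u v) ->
      (forall u v, cong (lower_pairs L w) u v -> Q u v) ->
      (forall p, p \in ps -> Q p.1 p.2) ->
      forall u v, fiber L w u -> fiber L w v -> Q u v].
Proof.
pose vw := [` fiber_vertex (fiber_refl HL w)]%fset.
have [r0 [r [size_r star]]] := n_comp_spanning_star (@graph_edge_sym w) vw.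
have /choice[lift liftP] (a : graph_vertices k L (fiber L w)) :
    exists u, fiber L w u /\ rs u = val a.
  by have [u wu ua] := (graph_verticesP k HL w _).1 (valP a); exists u.
exists [seq (lift r0, lift a) | a <- r]; split.
- by rewrite size_map size_r.
- by move=> _ /mapP[a _ ->] /=; split; case: (liftP r0); case: (liftP a).
move=> Q [Qr Qs Qt] Qrs Qlow Qps u v wu wv.
pose vu := [` fiber_vertex wu]%fset; pose vv := [` fiber_vertex wv]%fset.
have [[wlu lu] [wlv lv]] := (liftP vu, liftP vv).
have Qlift a b : Q (lift a) (lift b).
  apply: (star (fun a b => Q (lift a) (lift b))) => [|{}a {}b|{}a ar].
  - by split=> [x|x y|y x z]; [apply: Qr|apply: Qs|apply: Qt].
  - move=> /asboolP/graph_edgeP[x [y [wx wy xa yb xy]]].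
    have [[wla la] [wlb lb]] := (liftP a, liftP b).
    apply: (Qt x); first by apply: Qrs; rewrite // la.
    by apply: (Qt y); [apply: Qlow|apply: Qrs; rewrite // lb].
  - by apply: (Qps (lift r0, lift a)); apply/mapP; exists a.
apply: (Qt (lift vu)); first by apply: Qrs; rewrite // lu.
by apply: (Qt (lift vv)) => //; apply: Qrs; rewrite // lv.
Qed.

End FiberGraph.

(** * Ranks of lattices *)
Section Rank.
Variable n : nat.
Implicit Types (H : set 'rV[int]_n).

Lemma lattice_mulmx H m (A : 'M[int]_(m, n)) (c : 'rV[int]_m) :
  is_lattice H -> (forall i, H (row i A)) -> H (c *m A).
Proof.
move=> latH HA; rewrite mulmx_sum_row; apply: lattice_sum => // i.
by rewrite -[c 0 i]intz scaler_int; apply: latticeMz.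
Qed.

(** Induction on the number of coordinates that may be nonzero: a vector of [H]
    whose last allowed coordinate is nonzero and of least absolute value,
    together with a basis of the vectors for which this coordinate is 0, is a
    basis of [H]. *)
Lemma has_rank_flag (d : nat) H : is_lattice H ->
  (forall h, H h -> forall i : 'I_n, (d <= i)%N -> h 0 i = 0) ->
  exists r, has_rank H r.
Proof.
elim: d H => [|d IH] H latH H0.
  exists 0%N, 0; split=> [|c _]; last by apply/rowP => -[].
  apply/seteqP; split=> [h Hh|_ [c _ <-]].
    exists 0 => //; rewrite mulmx0; apply/rowP => i.
    by rewrite mxE (H0 h Hh i).
  by rewrite mulmx0; apply: lattice0.
have [[i [h1 [di Hh1 h1i]]]|allz] := pselect (exists (i : 'I_n) h,
    [/\ i = d :> nat, H h & h 0 i != 0]); last first.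
  apply: IH => // h Hh i; rewrite leq_eqVlt => /predU1P[di|]; last exact: H0.
  by apply: contrapT => /eqP hi; apply: allz; exists i, h.
have exv : exists v, `[< exists h, [/\ H h, h 0 i != 0 & `|(h 0 i)%R|%N = v] >].
  by exists `|(h1 0 i)%R|%N; apply/asboolP; exists h1.
case: (ex_minnP exv) => _ /asboolP[h0 [Hh0 h0i <-]] minh0 {h1 Hh1 h1i exv}.
pose H' := H `&` [set h | h 0 i = 0].
have latH' : is_lattice H'.
  split; first by split; [apply: lattice0|rewrite /= mxE].
  move=> x y [Hx x0] [Hy y0]; split; first exact: latticeB.
  by rewrite /= !mxE x0 y0 subr0.
have [r [A [HA freeA]]] : exists r, has_rank H' r.
  apply: IH => // h [Hh hi] j; rewrite leq_eqVlt => /predU1P[dj|]; last exact: H0.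
  by rewrite -[RHS]hi; congr (h 0 _); apply: val_inj; rewrite /= -dj di.
have Acomb (c : 'rV_r) : H' (c *m A) by rewrite HA; exists c.
exists (1 + r)%N, (col_mx h0 A); split=> [|c].
  apply/seteqP; split=> [h Hh|_ [c _ <-]]; last first.
    rewrite -[c]hsubmxK mul_row_col; apply: latticeD => //; last by case: (Acomb (rsubmx c)).
    apply: lattice_mulmx => // j; rewrite (_ : row j h0 = h0) //.
    by apply/rowP => l; rewrite mxE ord1.
  set q := divz (h 0 i) (h0 0 i).
  have [c _ cA] : [set c *m A | c in [set: 'rV_r]] (h - q *: h0).
    rewrite -HA; have Hr : H (h - q *: h0).
      by apply: latticeB => //; rewrite -[q]intz scaler_int; apply: latticeMz.
    split=> //=; apply: contrapT => /eqP ne.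
    have : (`|(h0 0 i)%R| <= `|((h - q *: h0) 0 i)%R|)%N.
      by apply: minh0; apply/asboolP; exists (h - q *: h0).
    rewrite !mxE -/q.
    have -> : h 0 i - q * h0 0 i = modz (h 0 i) (h0 0 i) by [].
    rewrite -lez_nat !abszE [X in _ <= X]ger0_norm ?modz_ge0 // leNgt.
    by rewrite ltz_mod.
  exists (row_mx q%:M c) => //; rewrite mul_row_col mul_scalar_mx cA.
  by rewrite addrC subrK.
rewrite -[c]hsubmxK mul_row_col => E.
have c1 : lsubmx c = 0.
  have [_ /= Ai] := Acomb (rsubmx c).
  have : (lsubmx c *m h0 + rsubmx c *m A) 0 i = 0 by rewrite E mxE.
  rewrite mxE Ai addr0 mxE big_ord1 => /eqP.
  rewrite mulf_eq0 (negPf h0i) orbF => /eqP c00.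
  by apply/rowP => j; rewrite ord1 c00 mxE.
by rewrite c1 mul0mx add0r in E; rewrite c1 (freeA _ E) row_mx0.
Qed.

Lemma has_rank_exists H : is_lattice H -> exists r, has_rank H r.
Proof.
move=> latH; apply: (@has_rank_flag n) => // h _ i; rewrite leqNgt.
by rewrite ltn_ord.
Qed.

(** Write a basis as an integer combination D of the given vectors. If there are
    fewer vectors than basis elements, the Smith normal form of D has a zero
    row, which yields a nontrivial relation between the basis elements. *)
Lemma has_rank_le_size H r (xs : seq 'rV[int]_n) : has_rank H r ->
  (forall K, is_lattice K -> (forall x, x \in xs -> K x) -> H `<=` K) ->
  (r <= size xs)%N.
Proof.
move=> [A [HA freeA]] Hxs; set m := size xs.
pose X := \matrix_(i < m) nth 0 xs i.
have [D AE] : exists D : 'M_(r, m), A = D *m X.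
  pose K := [set c *m X | c in [set: 'rV[int]_m]].
  have latK : is_lattice K.
    split; first by exists 0; rewrite ?mul0mx.
    by move=> _ _ [c _ <-] [d _ <-]; exists (c - d); rewrite ?mulmxBl.
  have KX x : x \in xs -> K x.
    move=> xxs; have lt_x : (index x xs < m)%N by rewrite index_mem.
    exists (delta_mx 0 (Ordinal lt_x)) => //.
    by rewrite -rowE rowK nth_index.
  have /choice[D DP] i : exists d : 'rV_m, row i A = d *m X.
    have [|d _ <-] := Hxs K latK KX (row i A); last by exists d.
    by rewrite HA; exists (delta_mx 0 i); rewrite // -rowE.
  exists (\matrix_i D i); apply/row_matrixP => i.
  by rewrite row_mul rowK DP.
rewrite leqNgt; apply/negP => lt_mr.
have [L uL [R uR [d _ DE]]] := int_Smith_normal_form D.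
have r_gt0 : (r.-1 < r)%N by rewrite prednK // (leq_ltn_trans _ lt_mr).
pose last := Ordinal r_gt0; set S := (X in L *m X *m R) in DE.
have S0 : row last S = 0.
  apply/rowP => j; rewrite !mxE; case: eqP => [E|_]; last by rewrite mulr0n.
  by have := ltn_ord j; rewrite -E /= ltnNge -ltnS prednK // (leq_ltn_trans _ lt_mr).
have := freeA (row last (invmx L)).
rewrite AE DE -!mulmxA mulmxA -row_mul mulVmx // rowE.
rewrite -rowE row1 !mulmxA -rowE S0 !mul0mx => /(_ erefl) E.
have := congr1 (mulmx^~ L) E; rewrite -row_mul mulVmx // mul0mx row1.
by move/rowP/(_ last); rewrite !mxE !eqxx.
Qed.

End Rank.

(** * Nonnegative generators of the pure part *)
Section PureBasis.
Variables (n : nat) (L : set 'rV[int]_n).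
Hypothesis HL : is_lattice L.
Implicit Types (u v : 'X_{1..n}).

Lemma Lpure_lattice : is_lattice (Lpure L).
Proof.
split=> [K [latK _]|x y Lx Ly K KP]; first exact: lattice0.
by case: (KP) => latK _; apply: latticeB => //; [apply: Lx|apply: Ly].
Qed.

Lemma Lpure_sub : Lpure L `<=` L.
Proof. by apply: smallest_sub => // w []. Qed.

Lemma Lpure_supp h i : Lpure L h -> ~ sigma L i -> h 0 i = 0.
Proof.
move=> Lh nsi; suff : Lpure L `<=` [set h | h 0 i = 0] by apply.
apply: smallest_sub.
  by split=> [|x y /= x0 y0]; rewrite /= !mxE // x0 y0 subr0.
by move=> w Lw /=; apply: contrapT => /eqP wi; apply: nsi; exists w.
Qed.

Lemma Lpure_expZ u : L (expZ u) -> Lpure L (expZ u).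
Proof. by move=> Lu; apply: sub_gen_smallest; split=> // i; rewrite mxE. Qed.

(** The Smith normal form of the coordinates of a vector p in L^+ with full
    support changes the basis so that p becomes a multiple of the first basis
    vector; up to sign this vector b is then itself nonnegative with full support.
    Adding large multiples of b makes the other basis vectors nonnegative. *)
Lemma Lpure_nonneg_generators r : has_rank (Lpure L) r ->
  exists B : 'I_r -> 'X_{1..n}, (forall i, L (expZ (B i))) /\
  forall K, is_lattice K -> (forall i, K (expZ (B i))) -> Lpure L `<=` K.
Proof.
case: r => [|r] [A [HA _]].
  exists (fun=> 0%MM); split=> [[]//|K latK _ h]; rewrite HA => -[c _ <-].
  by apply: lattice_mulmx => // -[].
have [p [Lp pP]] := full_support_element HL.
have [c _ cA] : [set c *m A | c in [set: 'rV_r.+1]] (expZ p).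
  by rewrite -HA; apply: Lpure_expZ.
have [U uU [R uR [d _ cE]]] := int_Smith_normal_form c.
pose a i := row i (R *m A).
have La i : Lpure L (a i).
  by rewrite HA; exists (row i R); rewrite // /a row_mul.
have span K : is_lattice K -> (forall i, K (a i)) -> Lpure L `<=` K.
  move=> latK Ka h; rewrite HA => -[e _ <-].
  by rewrite -(mulKmx uR A) (mulmxA e); apply: lattice_mulmx.
pose z := U 0 0 * d`_0.
have zE : expZ p = z *: a 0.
  rewrite -cA cE -!mulmxA; set D := \matrix_(i, j) _.
  have -> : D = d`_0 *: delta_mx 0 0.
    apply/matrixP => i j; rewrite !mxE ord1 /= eq_sym.
    by case: (j == 0 :> nat) / eqP => j0; rewrite -val_eqE /= ?j0 ?eqxx ?mulr1 //;
      move/eqP/negPf: j0 => ->; rewrite mulr0.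
  rewrite -scalemxAl -rowE [U]mx11_scalar mul_scalar_mx scalerA.
  by rewrite /a.
(* z = 0 means p = 0, so sigma is empty and L_pure is trivial *)
have [z0|zn0] := eqVneq z 0.
  exists (fun=> 0%MM); split=> [_|K latK _ h Lh]; first by rewrite expZ0; apply: lattice0.
  suff -> : h = 0 by apply: lattice0.
  apply/rowP => i; rewrite [RHS]mxE; apply: Lpure_supp => // /pP.
  have /rowP/(_ i) := zE; rewrite z0 scale0r !mxE => /eqP.
  by rewrite eqz_nat => ->.
have pos_multiple (t : int) x : 0 < t -> expZ p = t *: x ->
    expZ (pos_part x) = x /\ forall i, sigma L i -> pos_part x i != 0%N.
  move=> t0 px; have xE : expZ (pos_part x) = x.
    apply: expZ_pos_part => i; move/rowP/(_ i): px; rewrite !mxE => px.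
    by rewrite -(pmulr_rge0 _ t0) -px.
  split=> // i /pP; apply: contraNneq => xi0.
  by move/rowP/(_ i): px; rewrite -xE !mxE xi0 mulr0 => /eqP; rewrite eqz_nat.
have [b [Lb bP ab]] : exists b : 'X_{1..n}, [/\ Lpure L (expZ b),
    forall i, sigma L i -> b i != 0%N & a 0 = expZ b \/ a 0 = - expZ b].
  case: (ltrgt0P z) zn0 zE => // zs _ zE.
    have [aE aP] := pos_multiple z (a 0) zs zE.
    by exists (pos_part (a 0)); split=> //; [rewrite aE|left].
  have [||aE aP] := pos_multiple (- z) (- a 0); first by rewrite oppr_gt0.
    by rewrite scalerN scaleNr opprK.
  exists (pos_part (- a 0)); split=> //; last by right; rewrite aE opprK.
  by rewrite aE; apply: (latticeN Lpure_lattice).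
pose N i := mdeg (pos_part (- a i)).
pose B i := if i == 0 then b else pos_part (a i + expZ (b *+ N i)%MM).
have LNb i : Lpure L (expZ (b *+ N i)%MM).
  by rewrite expZMn; apply: (latticeMn Lpure_lattice).
have BE i : i != 0 -> expZ (B i) = a i + expZ (b *+ N i)%MM.
  move=> i0; rewrite /B (negPf i0) expZ_pos_part // => j.
  have [sj|nsj] := pselect (sigma L j); last first.
    by rewrite (@Lpure_supp _ j) //; apply: (latticeD Lpure_lattice).
  rewrite (pos_partB (a i)) addrAC -addrA mxE addr_ge0 //; first by rewrite mxE.
  by rewrite !mxE subr_ge0 lez_nat; apply/leq_mulm_mdeg/bP.
exists B; split=> [i|K latK KB].
  have [->|i0] := eqVneq i 0; first by rewrite /B eqxx; apply: Lpure_sub.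
  by rewrite BE //; apply: Lpure_sub; apply: (latticeD Lpure_lattice).
have Kb : K (expZ b) by have := KB 0; rewrite /B eqxx.
apply: span => // i; have [->|i0] := eqVneq i 0.
  by case: ab => ->; [|apply: (latticeN latK)].
rewrite -[a i](addrK (expZ (b *+ N i)%MM)) -BE //; apply: (latticeB latK) => //.
by rewrite expZMn; apply: (latticeMn latK).
Qed.

End PureBasis.

(** * Finite generation *)
Section Bounds.
Variables (k : fieldType) (n : nat) (L : set 'rV[int]_n).
Hypothesis HL : is_lattice L.
Implicit Types (u v w : 'X_{1..n}) (ps : seq ('X_{1..n} * 'X_{1..n})).

Notation rs := (restr_sigma L).

Definition pair_rel ps : 'X_{1..n} -> 'X_{1..n} -> Prop :=
  fun a b => (a, b) \in ps.

Definition generating_pairs ps :=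
  (forall p, p \in ps -> fiber L p.1 p.2) /\
  (forall u v, fiber L u v -> cong (pair_rel ps) u v).

Let pair_coord (p : 'X_{1..n} * 'X_{1..n}) (i : 'I_n + 'I_n) : nat :=
  match i with inl i => p.1 i | inr i => p.2 i end.

(** The minimal nonzero elements of the monoid of pairs (u, v) with u - v in L.
    They form an antichain and generate the monoid. *)
Let primitive_pairs : set ('X_{1..n} * 'X_{1..n}) := [set p |
  [/\ fiber L p.1 p.2, p <> (0, 0)%MM & forall a b, fiber L a b ->
    (a, b) <> (0, 0)%MM -> (a <= p.1)%MM -> (b <= p.2)%MM -> (a, b) = p]].

(** A pair (u, v) above a smaller pair (a, b) splits as the sum of (a, b) and
    (u - a, v - b), and u is related to v through (u - a) + b. *)
Let cong_primitive u v : fiber L u v -> cong (fun a b => primitive_pairs (a, b)) u v.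
Proof.
elim: (mdeg u + mdeg v)%N {-2}u {-2}v (leqnn (mdeg u + mdeg v)) => {u v} [|d IH] u v.
  rewrite leqn0 addn_eq0 !mdeg_eq0 => /andP[/eqP -> /eqP ->] _.
  exact: cong_refl.
move=> uvd uv; have [[-> ->]|uv0] := pselect ((u, v) = (0, 0)%MM); first exact: cong_refl.
have [prim|] := pselect (primitive_pairs (u, v)); first exact: cong_gen.
have [[a [b [ab ab0 au bv abuv]]] _|nab []] := pselect (exists a b, [/\ fiber L a b,
    (a, b) <> (0, 0)%MM, (a <= u)%MM, (b <= v)%MM & (a, b) <> (u, v)]); last first.
  split=> // a b ab ab0 au bv; apply: contrapT => ne; apply: nab.
  by exists a, b.
have degE : (mdeg u + mdeg v = (mdeg (u - a)%MM + mdeg (v - b)%MM) + (mdeg a + mdeg b))%N.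
  by rewrite addnACA -!mdegD !submK.
have pos x y : (x, y) <> (0, 0)%MM :> 'X_{1..n} * 'X_{1..n} -> (0 < mdeg x + mdeg y)%N.
  by move=> ne; rewrite lt0n addn_eq0 !mdeg_eq0; apply/negP => /andP[/eqP E1 /eqP E2];
    apply: ne; rewrite E1 E2.
have ab_pos := pos _ _ ab0.
have uv_pos : (0 < mdeg (u - a)%MM + mdeg (v - b)%MM)%N.
  apply: pos => /pair_equal_spec[E1 E2]; apply: abuv.
  by rewrite -(submK au) -(submK bv) E1 E2 !add0m.
apply: (@cong_trans _ _ (u - a + b)%MM).
  rewrite -{1}(submK au); apply: cong_add; apply: IH => //.
  by rewrite -ltnS; apply: leq_trans uvd; rewrite degE -[X in (X < _)%N]add0n ltn_add2r.
rewrite -{1}(submK bv) ![(_ + b)%MM]addmC; apply: cong_add; apply: IH.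
  by rewrite -ltnS; apply: leq_trans uvd; rewrite degE -[X in (X < _)%N]addn0 ltn_add2l.
rewrite /fiber /= !expZB // opprD addrACA -opprD.
exact: latticeB.
Qed.

Lemma finitely_generated : exists ps, generating_pairs ps.
Proof.
have /finite_seqP[ps psE] : finite_set primitive_pairs.
  apply: (@dickson _ _ pair_coord) => -[a b] [c d] [ab ab0 _] [_ _ cdP] le.
  apply: cdP => //; apply/mnm_lepP => i; first exact: (le (inl i)).
  exact: (le (inr i)).
exists ps; split=> [p pps|u v /cong_primitive].
  by have : [set` ps] p by []; rewrite -psE => -[].
by apply: cong_sub => a b; rewrite psE => ab; apply: cong_gen.
Qed.

(** * Lower bounds, class by class *)

(** [t_class] is computed on the fiber that [xget] selects in the class. *)
Lemma class_rep w : exists2 w', xget set0 (class L w) = fiber L w' & class L w' = class L w.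
Proof.
have : class L w (xget set0 (class L w)).
  apply: xgetPex; exists (fiber L w); split; first by exists w.
  by apply/(fiber_equivP HL); split; apply/(fiber_exp_le HL)/(fiber_refl HL).
move=> [[w' E] /[!E] /(fiber_equivP HL)[le1 le2]]; exists w' => //.
by apply/(fiber_class_eqP HL).
Qed.

Lemma generators_in_class ps w : generating_pairs ps ->
  (t_class k L (class L w) - 1 <= count (fun p => class L p.1 == class L w) ps)%N.
Proof.
move=> [psL Lps]; rewrite leq_subLR add1n /t_class.
have [w' -> <-] := class_rep w.
apply: leq_trans (num_components_le k HL w' psL Lps) _; rewrite ltnS.
apply: sub_count => p /asboolP[le1 le2] /=; apply/eqP.
by apply/(fiber_class_eqP HL).
Qed.

(** An element m of L^+ is joined to 0 by moves inside the fiber of 1, and each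
    such move only uses pairs of the class of 1; so m is an integer combination of
    the differences of these pairs. *)
Lemma generators_in_class0 ps : generating_pairs ps ->
  (lattice_rank (Lpure L) <= count (fun p => class L p.1 == class L 0%MM) ps)%N.
Proof.
move=> [psL Lps]; set P := (fun p => _).
rewrite -size_filter -(size_map (fun p => expZ p.1 - expZ p.2)).
have rankL : has_rank (Lpure L) (lattice_rank (Lpure L)).
  by apply: xgetPex; apply: has_rank_exists; apply: Lpure_lattice.
apply: (has_rank_le_size rankL) => K latK Kps; apply: smallest_sub => // w [Lw w0].
rewrite -(expZ_pos_part w0) -[X in K X]subr0 -(expZ0 n).
set m := pos_part w; have m0 : fiber L 0%MM m by rewrite /fiber /= expZ0 subr0 expZ_pos_part.
suff H u v : cong (pair_rel ps) u v -> fiber L 0%MM u -> K (expZ u - expZ v).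
  apply: H => //; apply: Lps; exact: fiber_sym.
have ps_fiber x y : cong (pair_rel ps) x y -> fiber L x y.
  by move=> xy; apply/(fiber_cong HL); apply: cong_sub xy => a b /psL /=;
    apply: cong_gen.
elim=> {u v} [c a b ab ca|u _|u v uv IH v0|v u w' uv IH1 vw IH2 u0].
- rewrite !expZD opprD addrACA subrr add0r; apply: Kps.
  apply/mapP; exists (a, b) => //; rewrite mem_filter ab andbT /P.
  apply/eqP/(fiber_class_eqP HL); split; last exact: exp_le0.
  by exists c.
- by rewrite subrr; apply: lattice0.
- rewrite -opprB; apply: latticeN => //; apply: IH.
  by apply: (fiber_trans HL v0); apply: (fiber_sym HL); apply: ps_fiber.
- rewrite -(subrKA (expZ v)); apply: latticeD => //; first exact: IH1.
  by apply: IH2; apply: fiber_trans u0 _ => //; apply: ps_fiber.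
Qed.

(** * A generating set built from stars *)

Lemma restrD u v : rs (u + v)%MM = (rs u + rs v)%MM.
Proof. by apply/mnmP => i; rewrite !(mnmE, mnmDE); case: ifP. Qed.

Lemma restr_eq0_invertible c : rs c = 0%MM -> invertible_mon L c.
Proof.
by move=> c0; rewrite -(sigma_partK L c) c0 addm0; apply: sigma_part_invertible.
Qed.

(** The measure for the induction over classes: it strictly decreases with the
    class, because a monomial that is not invertible has positive degree outside
    sigma. *)
Lemma restr_fiber_bounded w : exists d, forall v, fiber L w v -> (mdeg (rs v) <= d)%N.
Proof.
have /finite_seqP[s sE] := finite_restr_fiber HL w.
exists (\max_(x <- s) mdeg x)%N => v wv; apply: leq_bigmax_seq => //.
by have : [set` s] (rs v) by rewrite -sE; exists v.
Qed.

Section Generation.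
Variable P : 'X_{1..n} -> 'X_{1..n} -> Prop.

(** [P] contains pairs (b, 0) where the vectors b generate L_pure. *)
Hypothesis P_units : exists2 B : seq 'X_{1..n}, forall u, u \in B -> P u 0%MM &
  forall K, is_lattice K -> (forall u, u \in B -> K (expZ u)) -> Lpure L `<=` K.

(** Each element of L_pure is a difference of two monomials a, b related to 1;
    if it equals u - v then u + b = v + a, where u + b is related to u and v + a
    to v. *)
Lemma cong_invertible u v : invertible_mon L u -> fiber L u v -> cong P u v.
Proof.
move=> [d Lud] uv; have [B PB BL] := P_units.
pose K := [set h : 'rV[int]_n | exists a b,
  [/\ h = expZ a - expZ b, cong P a 0%MM & cong P b 0%MM]].
have latK : is_lattice K.
  split; first by exists 0%MM, 0%MM; split; [rewrite subrr|apply: cong_refl|apply: cong_refl].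
  move=> _ _ [a [b [-> a0 b0]]] [c [e [-> c0 e0]]].
  exists (a + e)%MM, (b + c)%MM; split.
  - by rewrite !expZD opprB addrACA -opprD.
  - by apply: cong_trans e0; rewrite -[X in cong _ _ X]add0m ![(_ + e)%MM]addmC; apply: cong_add.
  - by apply: cong_trans c0; rewrite -[X in cong _ _ X]add0m ![(_ + c)%MM]addmC; apply: cong_add.
have [a [b [E a0 b0]]] : K (expZ u - expZ v).
  apply: (BL K latK) => [w /PB Pw|].
    exists w, 0%MM; split; [by rewrite expZ0 subr0|exact: cong_gen|exact: cong_refl].
  have -> : expZ u - expZ v = expZ (u + d)%MM - expZ (v + d)%MM.
    by rewrite !expZD opprD addrACA subrr addr0.
  apply: (latticeB (Lpure_lattice L)); apply: Lpure_expZ => //.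
  have -> : expZ (v + d)%MM = (expZ v - expZ u) + expZ (u + d)%MM.
    by rewrite !expZD addrA subrK.
  exact: latticeD.
have ubva : (u + b = v + a)%MM.
  apply/mnmP => i; move/rowP/(_ i)/eqP: E; rewrite !mxE !mnmDE.
  by rewrite subr_eq addrAC eq_sym subr_eq -!PoszD => /eqP[]; rewrite addnC => ->.
apply: (@cong_trans _ _ (u + b)%MM).
  by rewrite -{1}[u]addm0; apply/cong_add/cong_sym.
by rewrite ubva -{2}[v]addm0; apply: cong_add.
Qed.

Lemma cong_restr u v : fiber L u v -> rs u = rs v -> cong P u v.
Proof.
move=> uv ruv; rewrite -(sigma_partK L u) -(sigma_partK L v) ruv.
rewrite ![(_ + rs v)%MM]addmC; apply: cong_add; apply: cong_invertible.
  exact: sigma_part_invertible.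
rewrite -(fiber_add L (rs v)) ![(rs v + _)%MM]addmC sigma_partK -ruv.
by rewrite sigma_partK.
Qed.

(** Multiply by the inverse x^d of x^c modulo the congruence. *)
Lemma cong_cancel c u v : invertible_mon L c -> cong P (c + u)%MM (c + v)%MM -> cong P u v.
Proof.
move=> [d Lcd] cuv.
have dc0 : cong P 0%MM (d + c)%MM.
  apply/cong_sym/cong_invertible.
    by exists 0%MM; rewrite addm0 addmC.
  by apply: fiber_sym => //; rewrite /fiber /= expZ0 subr0 addmC.
have add x : cong P x (d + c + x)%MM.
  by rewrite -{1}[x]addm0 [(_ + x)%MM]addmC; apply: cong_add.
apply: cong_trans (add u) _; apply: cong_trans (cong_sym (add v)).
by rewrite -!addmA; apply: cong_add.
Qed.

(** In each class other than that of 1, [P] contains pairs that connect the graph of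
    some fiber of the class. *)
Hypothesis P_classes : forall w, ~ exp_le L w 0%MM ->
  exists2 w', same_class L w w' &
  forall Q, equiv_rel Q ->
    (forall u v, fiber L w' u -> fiber L w' v -> rs u = rs v -> Q u v) ->
    (forall u v, cong (lower_pairs L w') u v -> Q u v) ->
    (forall u v, P u v -> Q u v) ->
    forall u v, fiber L w' u -> fiber L w' v -> Q u v.

(** Move u and v by an invertible factor into the fiber on which [P_classes] is
    available, connect them there, and cancel the factor. *)
Lemma fiber_cong_generated u v : fiber L u v -> cong P u v.
Proof.
have [d] := restr_fiber_bounded u; elim/ltn_ind: d u v => d IH u v ud uv.
have [/(invertible_monP L) u1|nu1] := pselect (exp_le L u 0%MM); first exact: cong_invertible.
have [w [wu uw] total] := P_classes nu1.
have [c c1 wcu] := equiv_translate HL uw wu.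
apply: (@cong_cancel c) => //; apply: (total (cong P)) => //.
- by split=> [x|x y|y x z]; [apply: cong_refl|apply: cong_sym|apply: cong_trans].
- by move=> x y wx wy; apply: cong_restr; apply: fiber_trans wy => //; apply: fiber_sym.
- move=> x y; apply: cong_sub => {x y} x y [xy [[e wex] nwx]].
  have [f f1 ufw] := equiv_translate HL wu uw.
  have e_gt0 : (0 < mdeg (rs e))%N.
    rewrite lt0n mdeg_eq0; apply/eqP => /restr_eq0_invertible e1; apply: nwx.
    apply: (exp_le_trans HL (fiber_exp_le HL wex)); exact: exp_le_invertible.
  have deg_le z : fiber L x z -> (mdeg (rs e) + mdeg (rs z) <= d)%N.
    move=> xz; rewrite -mdegD -restrD -(restr_addl _ f1); apply: ud.
    apply: (fiber_trans HL ufw); rewrite fiber_add.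
    by apply: (fiber_trans HL wex); rewrite fiber_add.
  apply: (IH (d - mdeg (rs e))%N) => // [|z xz].
    by rewrite ltn_subrL e_gt0 (leq_trans e_gt0) // (leq_trans _ (deg_le x (fiber_refl HL x))) ?leq_addr.
  by rewrite leq_subRL ?deg_le // (leq_trans _ (deg_le z xz)) ?leq_addr.
- by move=> x y; apply: cong_gen.
- by apply: fiber_trans wcu _ => //; rewrite fiber_add.
Qed.

End Generation.

End Bounds.

(** * Comparing cardinalities *)
Section Counting.
Variables (k : fieldType) (n : nat) (L : set 'rV[int]_n).
Hypothesis HL : is_lattice L.
Implicit Types (u v w : 'X_{1..n}) (ps : seq ('X_{1..n} * 'X_{1..n})).

(** [D] lists the classes, other than that of 1, that may have several
    components; the other classes need no pair of their own, which keeps the family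
    finite. *)
Lemma optimal_generators (D : seq (set (set 'X_{1..n}))) :
  (forall C, C \in D -> exists w, C = class L w) ->
  (forall w, class L w <> class L 0%MM -> class L w \notin D ->
    (t_class k L (class L w) - 1 = 0)%N) ->
  exists2 ps, generating_pairs L ps &
    (size ps <= lattice_rank (Lpure L) + \sum_(C <- D) (t_class k L C - 1))%N.
Proof.
move=> Dclass Dt.
have rankL : has_rank (Lpure L) (lattice_rank (Lpure L)).
  by apply: xgetPex; apply: has_rank_exists; apply: Lpure_lattice.
have [B [LB BL]] := Lpure_nonneg_generators HL rankL.
have /choice[f fP] (C : set (set 'X_{1..n})) : exists ps, (exists w, C = class L w) ->
    size ps = (t_class k L C - 1)%N /\ exists w, [/\ C = class L w,
    forall p, p \in ps -> fiber L w p.1 /\ fiber L w p.2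
    & forall Q, equiv_rel Q ->
      (forall u v, fiber L w u -> fiber L w v ->
        restr_sigma L u = restr_sigma L v -> Q u v) ->
      (forall u v, cong (lower_pairs L w) u v -> Q u v) ->
      (forall p, p \in ps -> Q p.1 p.2) ->
      forall u v, fiber L w u -> fiber L w v -> Q u v].
  have [[w ->]|nC] := pselect (exists w, C = class L w); last by exists [::] => /nC.
  have [w' wE w'w] := class_rep HL w.
  have [ps [ps_size psL psQ]] := fiber_spanning_pairs k HL w'.
  by exists ps => _; rewrite /t_class wE; split=> //; exists w'.
pose units := [seq (B i, 0%MM : 'X_{1..n}) | i <- enum 'I_(lattice_rank (Lpure L))].
pose ps := units ++ flatten [seq f C | C <- D].
exists ps; last first.
  rewrite size_cat size_map size_enum_ord leq_add2l size_flatten sumnE !big_map.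
  rewrite big_seq [leqRHS]big_seq; apply: leq_sum => C /Dclass CD.
  by have [-> _] := fP C CD.
split=> [p|u v].
  rewrite mem_cat => /orP[/mapP[i _ ->] /=|/flattenP[s /mapP[C CD ->] pC]].
    by apply: (fiber_sym HL); rewrite /fiber /= expZ0 subr0.
  have [_ [w [_ /(_ p pC)[w1 w2] _]]] := fP C (Dclass C CD).
  exact: fiber_trans (fiber_sym HL w1) w2.
apply: (fiber_cong_generated HL) => [|w nw0].
  exists [seq B i | i <- enum 'I_(lattice_rank (Lpure L))] => [_ /mapP[i _ ->]|].
    by rewrite /pair_rel mem_cat map_f ?mem_enum.
  move=> K latK KB; apply: BL => // i; apply: KB.
  by apply: map_f; rewrite mem_enum.
have [fsize [w' [ww' _ total]]] := fP (class L w) (ex_intro _ w erefl).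
have /(fiber_class_eqP HL)[le1 le2] := ww'.
exists w'; first by split.
move=> Q eqQ Qrs Qlow QP; apply: total => // p pw; apply: QP.
rewrite /pair_rel -surjective_pairing mem_cat; apply/orP; right.
apply/flattenP; exists (f (class L w)) => //; apply: map_f.
apply: contraT => wD; move: pw; rewrite (size0nil (_ : size (f (class L w)) = 0%N)) //.
by rewrite fsize Dt // => /(fiber_class_eqP HL)[].
Qed.

Lemma sum_count_le (I T : eqType) (g : T -> I) (D : seq I) (s : seq T) : uniq D ->
  (\sum_(i <- D) count (fun x => g x == i) s <= size s)%N.
Proof.
move=> uD; elim: s => [|x s IH] /=; first by rewrite big1.
rewrite big_split /= -add1n leq_add // {IH}.
have -> : (\sum_(i <- D) (g x == i) = count_mem (g x) D)%N.
  by rewrite -sum1_count [RHS]big_mkcond; apply: eq_bigr => i _ /=; rewrite eq_sym; case: eqP.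
by rewrite count_uniq_mem // leq_b1.
Qed.

(** Summing the lower bounds over the class of 1 and the classes in [D]; a
    generator in any further class makes the inequality strict. *)
Lemma generators_ge ps (D : seq (set (set 'X_{1..n}))) :
  generating_pairs L ps -> uniq (class L 0%MM :: D) ->
  (forall C, C \in D -> exists w, C = class L w) ->
  (lattice_rank (Lpure L) + \sum_(C <- D) (t_class k L C - 1) <= size ps)%N /\
  forall p, p \in ps -> class L p.1 \notin class L 0%MM :: D ->
  (lattice_rank (Lpure L) + \sum_(C <- D) (t_class k L C - 1) < size ps)%N.
Proof.
move=> gps uD Dclass.
have bound : (lattice_rank (Lpure L) + \sum_(C <- D) (t_class k L C - 1) <=
    \sum_(C <- class L 0%MM :: D) count (fun p => class L p.1 == C) ps)%N.
  rewrite big_cons leq_add ?generators_in_class0 //.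
  rewrite big_seq [leqRHS]big_seq; apply: leq_sum => C /Dclass[w ->].
  exact: generators_in_class.
split; first exact: leq_trans bound (sum_count_le (fun p => class L p.1) ps uD).
move=> p pps pD; have uD' : uniq [:: class L p.1, class L 0%MM & D] by rewrite cons_uniq pD.
apply: leq_trans (sum_count_le (fun p => class L p.1) ps uD').
rewrite big_cons -add1n leq_add // -has_count; apply/hasP.
by exists p.
Qed.

Lemma binomials_generateP (P : 'X_{1..n} -> 'X_{1..n} -> Prop) :
  ideal_gen (@binomials n k P) = lattice_ideal k L <->
  (forall u v, P u v -> fiber L u v) /\ (forall u v, fiber L u v -> cong P u v).
Proof.
split=> [E|[PL LP]].
  split=> u v uv.
    by apply/(lattice_idealP k HL); rewrite -E; apply/ideal_binomialsP/cong_gen.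
  by apply/(ideal_binomialsP k); rewrite E; apply/(lattice_idealP k HL).
apply/seteqP; split; apply: ideal_gen_min; try exact: ideal_gen_is_ideal.
  by move=> _ [u [v [/PL uv ->]]]; apply/(lattice_idealP k HL).
by move=> _ [u [v [/(fiber_sym HL) uv ->]]]; apply/ideal_binomialsP/LP.
Qed.

Lemma finite_generators (S : set {mpoly k[n]}) :
  S `<=` @is_binomial k n -> ideal_gen S = lattice_ideal k L -> finite_set S ->
  exists ps, [/\ generating_pairs L ps, S #= `I_(size ps)
    & S = [set B | exists2 p, p \in ps & B = 'X_[p.1] - 'X_[p.2]]].
Proof.
move=> Sbin Sgen finS.
have /choice[f fP] (B : {mpoly k[n]}) : exists p : 'X_{1..n} * 'X_{1..n},
    S B -> B = 'X_[p.1] - 'X_[p.2].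
  have [/Sbin[u [v [_ ->]]]|nSB] := pselect (S B); first by exists (u, v).
  by exists (0, 0)%MM.
pose s := enum_fset (fset_set S).
have sE B : (B \in s) <-> S B by rewrite (in_fset_set finS) inE.
pose ps := [seq f B | B <- s].
have ES : S = [set B | exists2 p, p \in ps & B = 'X_[p.1] - 'X_[p.2]].
  apply/seteqP; split=> [B SB|_ [_ /mapP[B /sE SB ->] ->]]; last by rewrite -fP.
  by exists (f B); [apply/map_f/sE|apply: fP].
have ESb : S = binomials (pair_rel ps).
  rewrite {1}ES; apply/seteqP; split=> [_ [[a b] ab ->]|_ [a [b [ab ->]]]].
    by exists a, b.
  by exists (a, b).
exists ps; split=> //.
  move: Sgen; rewrite ESb => /binomials_generateP[PL LP]; split=> // -[a b].
  exact: PL.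
rewrite size_map; have [m Sm] := (finite_setP S).1 finS.
by rewrite -[size s]/#|` fset_set S|%fset (card_fset_set Sm).
Qed.

End Counting.

(** * Markov classes *)
Section MarkovClasses.
Variables (k : fieldType) (n : nat) (L : set 'rV[int]_n).
Hypothesis HL : is_lattice L.
Variable D : seq (set (set 'X_{1..n})).
Hypothesis uD : uniq (class L 0%MM :: D).
Hypothesis Dclass : forall C, C \in D -> exists w, C = class L w.
Hypothesis Dt : forall w, class L w <> class L 0%MM -> class L w \notin D ->
  (t_class k L (class L w) - 1 = 0)%N.

Let N := (lattice_rank (Lpure L) + \sum_(C <- D) (t_class k L C - 1))%N.

Lemma card_generators_ge (S : set {mpoly k[n]}) :
  S `<=` @is_binomial k n -> ideal_gen S = lattice_ideal k L -> `I_N #<= S.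
Proof.
move=> Sbin Sgen; have [finS|infS] := pselect (finite_set S); last first.
  by apply: card_le_trans ((infiniteP S).1 infS); apply: card_leT.
have [qs [gqs Sqs _]] := finite_generators HL Sbin Sgen finS.
rewrite (card_le_eqr Sqs) card_le_II.
by have [] := generators_ge k HL gqs uD Dclass.
Qed.

(** The binomials of the optimal pairs attain the lower bound, so there are
    exactly [N] of them and none can be dropped. *)
Lemma cardinality_minimal_exists : exists T : set {mpoly k[n]},
  cardinality_minimal L T /\ T #= `I_N.
Proof.
have [ps [psL Lps] ps_size] := optimal_generators HL Dclass Dt.
pose T := @binomials n k (fun a b => a != b /\ (a, b) \in ps).
have Tbin : T `<=` @is_binomial k n by move=> _ [a [b [[ab _] ->]]]; exists a, b.
have Tgen : ideal_gen T = lattice_ideal k L.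
  apply/(binomials_generateP k HL); split=> [u v [_ /psL]//|u v /Lps].
  apply: cong_sub => a b ab; have [->|ne] := eqVneq a b; first exact: cong_refl.
  exact: cong_gen.
have TN : T #= `I_N.
  apply/card_eqPle; split; last exact: card_generators_ge.
  pose g i : {mpoly k[n]} :=
    let p := nth (0, 0)%MM ps i in 'X_[p.1] - 'X_[p.2].
  have Tg : T `<=` g @` `I_(size ps).
    move=> _ [a [b [[_ ab] ->]]]; exists (index (a, b) ps); rewrite /= ?index_mem //.
    by rewrite /g nth_index.
  apply: card_le_trans (subset_card_le Tg) _.
  apply: card_le_trans (card_image_le _ _) _.
  by rewrite card_le_II.
have finT : finite_set T by apply/finite_setP; exists N.
exists T; split=> //; split; last first.
  by move=> S [Sbin [Sgen _]]; rewrite (card_le_eql TN); apply: card_generators_ge.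
split=> //; split=> // T' T'T T'gen.
have finT' : finite_set T' by apply: sub_finite_set finT.
have [m T'm] := (finite_setP T').1 finT'.
apply: fset_set_inj => //; apply/eqP; rewrite eqEfcard; apply/andP; split.
  by rewrite -fset_set_sub.
rewrite (card_fset_set T'm) (card_fset_set TN) -card_le_II -(card_le_eqr T'm).
by apply: card_generators_ge => // B /T'T/Tbin.
Qed.

Lemma cardinality_minimal_card (S : set {mpoly k[n]}) :
  cardinality_minimal L S -> S #= `I_N.
Proof.
move=> [[Sbin [Sgen _]] Smin]; have [T [[Tmin _] TN]] := cardinality_minimal_exists.
apply/card_eqPle; split; last exact: card_generators_ge.
by rewrite -(card_le_eqr TN); apply: Smin.
Qed.

Lemma mu_eq : mu k L = N.
Proof.
apply: xget_unique; first exact: cardinality_minimal_exists.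
move=> m [S [/cardinality_minimal_card SN Sm]]; apply/card_eq_II.
by rewrite -(card_eql Sm).
Qed.

(** By the strict case of [generators_ge], a generating set with a binomial in a
    class outside [D] has more than [N] elements. *)
Lemma nontrivial_markov_classes_sub C : nontrivial_markov_classes k L C -> C \in D.
Proof.
move=> [[F [[w ->] [S [Scard [B [SB [G [[u [v [uv BE ->]]] uw]]]]]]]] <- /= w0].
apply: contrapT => /negP wD; have SN := cardinality_minimal_card Scard.
have [[Sbin [Sgen _]] _] := Scard.
have finS : finite_set S by apply/finite_setP; exists N.
have [qs [gqs Sqs SE]] := finite_generators HL Sbin Sgen finS.
have [[a b] pqs /= BE'] : [set B | exists2 p, p \in qs & B = 'X_[p.1] - 'X_[p.2]] B.
  by rewrite -SE.
have au : class L a = class L w.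
  rewrite -uw; congr fiber_class.
  (* in characteristic 2 the binomial does not order its two monomials *)
  case: (binomial_inj uv (etrans (esym BE) BE')) => -> //.
  by apply: (fiber_eq HL); case: gqs => /(_ _ pqs).
have [_ /(_ _ pqs)] := generators_ge k HL gqs uD Dclass.
rewrite /= au in_cons negb_or wD andbT => /(_ (introN eqP w0)).
by rewrite ltnNge -card_le_II -/N -(card_le_eql Sqs) card_eq_le in SN *; case/andP: SN => ->.
Qed.

(** A cardinality-minimal set meets the class by the lower bound. *)
Lemma nontrivial_markov_class C : C \in D -> (0 < t_class k L C - 1)%N ->
  nontrivial_markov_classes k L C.
Proof.
move=> CD tC; have [T [Tcard TN]] := cardinality_minimal_exists.
have [[Tbin [Tgen _]] _] := Tcard; have [w Cw] := Dclass CD.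
have finT : finite_set T by apply/finite_setP; exists N.
have [qs [gqs _ TE]] := finite_generators HL Tbin Tgen finT.
have : (0 < count (fun p => class L p.1 == C) qs)%N.
  by apply: leq_trans tC _; rewrite Cw; apply: generators_in_class.
rewrite -has_count => /hasP[p pqs /eqP pC].
have Tp : T ('X_[p.1] - 'X_[p.2]) by rewrite TE; exists p.
split; last by move=> /= C0; move: uD; rewrite cons_uniq -C0 CD.
exists (fiber L p.1) => //; split; first by exists p.1.
exists T; split=> //; exists ('X_[p.1] - 'X_[p.2]); split=> //.
exists (fiber L p.1); split=> //; exists p.1, p.2; split=> //.
apply/eqP => E; have [a [b [ab /eqP]]] := Tbin _ Tp.
rewrite E subrr eq_sym subr_eq0 => /eqP/mpolyX_inj abE.
by rewrite abE eqxx in ab.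
Qed.

End MarkovClasses.

(* t_class is at least 1 on every class, so no truncation occurs in t - 1. *)
Theorem theorem4p14 (k : fieldType) (n : nat) (L : set 'rV[int]_n)
  (HL : is_lattice L) :
  mu k L = (lattice_rank (Lpure L) +
    \big[addn/0]_(C \in nontrivial_markov_classes k L) (t_class k L C - 1))%N.
Proof.
(* a finite generating set meets every class with more than one component *)
have [ps gps] := finitely_generated HL.
pose D := rem (class L 0%MM) (undup [seq class L p.1 | p <- ps]).
have uD : uniq (class L 0%MM :: D).
  by rewrite cons_uniq mem_rem_uniq ?undup_uniq // inE eqxx rem_uniq ?undup_uniq.
have Dclass C : C \in D -> exists w, C = class L w.
  by move/mem_rem; rewrite mem_undup => /mapP[p _ ->]; exists p.1.
have Dt w : class L w <> class L 0%MM -> class L w \notin D ->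
    (t_class k L (class L w) - 1 = 0)%N.
  move=> /eqP w0 wD; apply/eqP; rewrite -leqn0.
  apply: leq_trans (generators_in_class k HL w gps) _; rewrite leqNgt.
  rewrite -has_count; apply/hasPn => p pps; apply: contra wD => /eqP pw.
  rewrite mem_rem_uniq ?undup_uniq // inE w0 mem_undup -pw.
  by apply: (map_f (fun p => class L p.1)).
rewrite (mu_eq HL uD Dclass Dt); congr addn.
rewrite (@fsbig_seq _ _ _ _ D) ?rem_uniq ?undup_uniq //.
apply/esym/fsbig_widen => [C|C [/= CD nC]].
  exact: (nontrivial_markov_classes_sub HL uD Dclass Dt).
apply: contrapT => /eqP; rewrite -lt0n => tC; apply: nC.
exact: (nontrivial_markov_class HL uD Dclass Dt).
Qed.
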